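(* Let $K$ be a field of characteristic $p>0$ and let $F\in\mathrm{GA}_2(K)$ be Pascal finite. Then $$|F|=p^{\lceil\log_p\tau_K(F)\rceil}\in\{1,p,p^2\}\quad\text{and}\quad \tau_K(F)\le p^2 .$$ Equivalently, $$|F|=1\iff\tau_K(F)=1,\qquad |F|=p\iff 2\le\tau_K(F)\le p,\qquad |F|=p^2\iff p+1\le\tau_K(F)\le p^2 .$$ Both nontrivial values $p$ and $p^2$ occur as orders of Pascal finite elements of $\mathrm{GA}_2(K)$, and no higher order occurs.
   Context: $K[X]=K[X_1,\dots,X_n]$. $\mathrm{GA}_n(K)$ is the group of polynomial automorphisms of affine $n$-space over $K$: an element is a tuple $F=(F_1,\dots,F_n)\in K[X]^n$ that has a two-sided inverse in $K[X]^n$ under the composition $(F\circ G)_i=F_i\circ G=F_i(G_1,\dots,G_n)$; the identity is $\mathrm{Id}=(X_1,\dots,X_n)$. $|F|$ denotes the order of $F$ in this group. For $F\in K[X]^n$ let $\sigma_F\colon K[X]\to K[X]$, $\sigma_F(P)=P\circ F=P(F_1,\dots,F_n)$, and $\Delta_F=\sigma_F-\mathrm{Id}$, i.e. $\Delta_F(P)=P\circ F-P$. For $g\in K[X]$ the Pascal depth of $g$ with respect to $F$ is $\tau_K^F(g)=\min\{m\ge1:\Delta_F^m(g)=0\}$, with value $\infty$ if no such $m$ exists. Set $\tau_K(F)=\max_{1\le i\le n}\tau_K^F(X_i)$ (the Pascal depth of $F$). $F$ is called Pascal finite if $\tau_K(F)<\infty$. *)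

(* Defs.v *)
From mathcomp Require Import all_boot all_order all_algebra.
From mathcomp Require Import boolp.
From mathcomp Require Export mpoly.

Set Implicit Arguments.
Unset Strict Implicit.
Unset Printing Implicit Defensive.

Import GRing.Theory.
Local Open Scope ring_scope.

(** Values in {1, 2, ...} with infinity are encoded in [option nat]:
    [None] stands for infinity. *)

Definition least_pos (P : pred nat) : option nat :=
  if pselect (exists m, (0 < m)%N && P m) is left exP
  then Some (ex_minn exP) else None.

Definition omax (a b : option nat) : option nat :=
  match a, b with
  | Some m, Some k => Some (maxn m k)
  | _, _ => None
  end.

Section PolynomialMaps.

Variables (K : fieldType) (n : nat).

Definition polymap : Type := n.-tuple {mpoly K[n]}.

Implicit Types (F G : polymap) (g P : {mpoly K[n]}).

Definition idpolymap : polymap := [tuple 'X_i | i < n].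

Definition compmap F G : polymap := [tuple comp_mpoly G (tnth F i) | i < n].

Definition GA F : Prop :=
  exists G, compmap F G = idpolymap /\ compmap G F = idpolymap.

Definition powmap F (m : nat) : polymap := iter m (compmap F) idpolymap.

Definition GA_order F : option nat := least_pos (fun m => powmap F m == idpolymap).

Definition sigma F P : {mpoly K[n]} := comp_mpoly F P.

Definition Delta F P : {mpoly K[n]} := sigma F P - P.

Definition pascal_depth_at F g : option nat :=
  least_pos (fun m => iter m (Delta F) g == 0).

(** The depths being positive, [Some 0] is neutral for their maximum. *)
Definition pascal_depth F : option nat :=
  \big[omax/Some 0%N]_(i < n) pascal_depth_at F 'X_i.

Definition pascal_finite F : Prop := pascal_depth F <> None.

End PolynomialMaps.

Arguments polymap : clear implicits.

(* Main.v *)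
From HB Require Import structures.
Require Import Defs.
From mathcomp Require Import all_boot all_order all_algebra.
From mathcomp Require Import boolp zify ring.
Import Order.TTheory GRing.Theory Num.Theory.
Set Implicit Arguments.
Unset Strict Implicit.
Unset Printing Implicit Defensive.
Local Open Scope ring_scope.

(** In characteristic p the operators Delta_F and sigma_F are related by
    Delta_F^(p^k) = sigma_F^(p^k) - Id, because (X - 1)^(p^k) = X^(p^k) - 1
    ([iter_Delta_pchar]).  So the depth of F is at most p^k exactly when
    F^(p^k) = Id, and the order of a Pascal finite F is the least power of p
    that is at least its depth ([GA_order_spec]).  Everything then rests on one
    fact: an automorphism of the plane whose order is a power of p satisfies
    F^(p^2) = Id ([order_dvd_psquare]).

    This follows from the structure of the group.  By the theorem of Jung and
    van der Kulk ([jung_van_der_kulk]) every automorphism is a product of affine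
    and triangular maps.  In a product of finite order, neighbours of the same
    kind can be merged, also across the two ends after a conjugation; a
    cyclically alternating product has infinite order, since its degree in y
    grows ([reduced_word_infinite_order]).  So an element of finite order is
    conjugate to one affine or triangular map ([finite_order_conj_letter]).  An
    affine map of p-power order is given by a unipotent 3 x 3 matrix M, and
    (M - 1)^3 = 0 with 3 <= p^2.  A triangular one is (x + q(y), y + c); its
    p-th power is (x + s(y), y), which has order dividing p.

    The theorem of Jung and van der Kulk is proved here in a way that does not
    depend on the characteristic.  Let f, g generate K[x, y], with degrees n e
    and b e in y, where n and b are coprime.  It is enough to show that n = 1 or
    b = 1 and that f^b / g^n has a constant residue at y = infinity: one of f, g
    can then be lowered by subtracting a multiple of a power of the other.  Put
    v = - deg_y on K(x, y) and let J be the Jacobian.  There are monomials pi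
    and theta in f and g with exponents of determinant 1, v(pi) = e and
    v(theta) = 0.  If P(f, g) = x, then P(f, g) = pi^-M W(pi, theta) where W is
    a polynomial and M the weighted degree of P; the polynomial W(0, theta) has
    at a nonzero point a root of some multiplicity k with n b k <= M
    ([toric_chart]).  Two estimates meet.  Since v(P(f, g)) = 0, the function
    W(pi, theta) has order e M along v.  On the other hand, resolving v by point
    blow-ups shows that a polynomial with a point of multiplicity k at the
    centre of v has order at most k (v(J) - 1) along v, J being the Jacobian of
    the local coordinates ([vanishing_order]): a blow-up divides J by the
    equation of the exceptional curve and does not raise the multiplicity.
    Here v(J) <= e (n + b + 1), since J(f, g) is a nonzero polynomial, so e M n b <= M (e (n + b + 1) - 1), that is
    n b < n + b + 1, and coprime n, b satisfy this only if one of them is 1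
    ([degree_divisibility]). *)

(** * Derivations and evaluation in two variables *)

Definition derivation (R : nzRingType) (D : R -> R) : Prop :=
  {morph D : a b / a + b} /\ forall a b, D (a * b) = D a * b + a * D b.

Section Derivations.
Variables (L : fieldType) (D : L -> L).
Hypothesis derD : derivation D.

Lemma der0 : D 0 = 0.
Proof. by case: derD => add _; apply: (addrI (D 0)); rewrite -add !addr0. Qed.

Lemma derN a : D (- a) = - D a.
Proof.
by case: derD => add _; apply: (addrI (D a)); rewrite -add !subrr der0.
Qed.

Lemma derM a b : D (a * b) = D a * b + a * D b.
Proof. by case: derD. Qed.

Lemma der_add a b : D (a + b) = D a + D b.
Proof. by case: derD. Qed.

Lemma der_div a b : b != 0 -> D (a / b) = (D a - (a / b) * D b) / b.
Proof.
move=> b0; have := derM (a / b) b; rewrite divfK // => ->.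
by field.
Qed.

Lemma derX a n : D (a ^+ n.+1) = a ^+ n * D a *+ n.+1.
Proof.
elim: n => [|n IH]; first by rewrite expr1 expr0 mul1r.
rewrite exprS derM IH mulrnAr mulrA -exprS [RHS]mulrS.
by rewrite mulrC.
Qed.

Lemma der_log_quot a b i j : a != 0 -> b != 0 ->
  D (a ^+ i / b ^+ j) = a ^+ i / b ^+ j * (D a / a *+ i - D b / b *+ j).
Proof.
have powE c n : c != 0 -> D (c ^+ n) = c ^+ n * (D c / c *+ n).
  move=> c0; case: n => [|n]; last first.
    by rewrite derX [RHS]mulrnAr exprS; congr (_ *+ _); field.
  rewrite mulr0n mulr0 expr0; apply: (addrI (D 1)); rewrite addr0.
  by rewrite -{3}[1]mulr1 derM mulr1 mul1r.
move=> a0 b0; rewrite der_div ?expf_neq0 // !powE //.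
move: (D a / a *+ i) (D b / b *+ j) (expf_neq0 j b0) => x y.
by move: (a ^+ i) (b ^+ j) => u w w0; field.
Qed.

End Derivations.

Definition at2 (R : Type) (f g : R) : 'I_2 -> R := tnth [tuple f; g].

Lemma mmap1_at2 (R : comNzRingType) (f g : R) (m : 'X_{1..2}) :
  mmap1 (at2 f g) m = f ^+ m ord0 * g ^+ m ord_max.
Proof.
rewrite /mmap1 !big_ord_recl big_ord0 mulr1 /at2 /=.
by congr (_ * _ ^+ _); congr (m _); apply: val_inj.
Qed.

Lemma ord2P (i : 'I_2) : i = ord0 \/ i = ord_max.
Proof. by case: i => [[|[|//]] lt]; [left|right]; apply: val_inj. Qed.

Lemma rmorph_mmap (n : nat) (K R S : comNzRingType) (phi : {rmorphism R -> S})
    (f : K -> R) (f' : K -> S) (h : 'I_n -> R) (h' : 'I_n -> S) (P : {mpoly K[n]}) :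
  (forall c, phi (f c) = f' c) -> (forall i, phi (h i) = h' i) ->
  phi (mmap f h P) = mmap f' h' P.
Proof.
move=> ff' hh'; rewrite /mmap rmorph_sum; apply: eq_bigr => m _.
rewrite rmorphM ff' /mmap1 rmorph_prod; congr (_ * _).
by apply: eq_bigr => i _; rewrite rmorphXn hh'.
Qed.

Lemma mnm2P (m1 m2 : 'X_{1..2}) :
  m1 ord0 = m2 ord0 -> m1 ord_max = m2 ord_max -> m1 = m2.
Proof.
move=> e0 e1; apply/mnmP => i.
by have [->|->] := ord2P i.
Qed.

Lemma bigmax_seq_attained (T : eqType) (s : seq T) (F : T -> nat) :
  (0 < \max_(x <- s) F x)%N -> exists2 x, x \in s & F x = \max_(x <- s) F x.
Proof.
elim: s => [|x s IH]; first by rewrite big_nil.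
rewrite big_cons /maxn; case: (ltnP (F x)) => [_ gt|_ _].
  have [y ys yM] := IH gt.
  by exists y => //; rewrite inE ys orbT.
by exists x => //; rewrite inE eqxx.
Qed.

(** * Valuations and blow-ups *)

(** The setting: a field L over K with a discrete valuation v that is trivial on
    K, and two derivations over K with their Jacobian.  Two properties tie the
    valuation to its geometry.  [vjac] says that v is bounded on logarithmic
    2-forms: v(J(a, b) / (a b)) >= 1.  [vres] says that an element whose residue
    is not in K has a residue that is transcendental over K. *)
Section BlowUp.

Variables (K L : fieldType) (iota : {rmorphism K -> L}) (v : L -> int).
Variables D1 D2 : L -> L.

Definition jac a b := D1 a * D2 b - D2 a * D1 b.
(** The coefficients are polynomials in the second argument; the outer variable
    is the first one. *)
Definition eval2 (a b : L) (W : {poly {poly K}}) : L :=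
  (map_poly (horner_eval b \o map_poly iota) W).[a].

Hypothesis der1 : derivation D1.
Hypothesis der2 : derivation D2.
Hypothesis der1c : forall c, D1 (iota c) = 0.
Hypothesis der2c : forall c, D2 (iota c) = 0.
Hypothesis vM : forall a b : L, a != 0 -> b != 0 -> v (a * b) = v a + v b.
Hypothesis vD : forall (a b : L) (m : int), a != 0 -> b != 0 -> a + b != 0 ->
  m <= v a -> m <= v b -> m <= v (a + b).
Hypothesis vc : forall c : K, c != 0 -> v (iota c) = 0.
Hypothesis vjac : forall a b, jac a b != 0 -> v a + v b + 1 <= v (jac a b).
Hypothesis vres : forall z, 0 <= v z ->
  (forall c, z - iota c != 0 /\ v (z - iota c) <= 0) ->
  forall q : {poly K}, q != 0 ->
  (map_poly iota q).[z] != 0 /\ v (map_poly iota q).[z] = 0.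

Lemma v1 : v 1 = 0.
Proof. by rewrite -(rmorph1 iota) vc ?oner_eq0. Qed.

Lemma vN (a : L) : v (- a) = v a.
Proof.
have [->|a0] := eqVneq a 0; first by rewrite oppr0.
have n1 : v (-1) = 0 by rewrite -(rmorphN1 iota) vc // oppr_eq0 oner_eq0.
by rewrite -mulN1r vM ?n1 ?add0r // oppr_eq0 oner_eq0.
Qed.

Lemma vV (a : L) : a != 0 -> v a^-1 = - v a.
Proof.
move=> a0; apply: (addrI (v a)); rewrite -vM ?invr_eq0 //.
by rewrite divff // v1 subrr.
Qed.

Lemma vX (a : L) n : a != 0 -> v (a ^+ n) = v a *+ n.
Proof.
move=> a0; elim: n => [|n IH]; first by rewrite v1.
by rewrite exprS vM ?expf_neq0 // IH mulrS.
Qed.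

Definition integral (a : L) := (a == 0) || (0 <= v a).

Lemma integral_add a b : integral a -> integral b -> integral (a + b).
Proof.
rewrite /integral.
have [->|a0] := eqVneq a 0; first by rewrite add0r.
have [->|b0] := eqVneq b 0; first by rewrite addr0 (negPf a0).
case: eqVneq => //= ab0 va vb; exact: vD.
Qed.

Lemma integral_mul a b : integral a -> integral b -> integral (a * b).
Proof.
rewrite /integral.
have [->|a0] := eqVneq a 0; first by rewrite mul0r eqxx.
have [->|b0] := eqVneq b 0; first by rewrite mulr0 eqxx.
by move=> /= va vb; rewrite vM // addr_ge0 ?orbT.
Qed.

Lemma integral_horner (p : {poly L}) a :
  integral a -> (forall i, integral p`_i) -> integral p.[a].
Proof.
move=> ia; elim/poly_ind: p => [|p c IH] ip; first by rewrite horner0 /integral eqxx.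
rewrite hornerMXaddC; apply: integral_add.
  apply: integral_mul ia; apply: IH => i.
  by have := ip i.+1; rewrite coefD coefMX coefC addr0.
by have := ip 0; rewrite coefD coefMX coefC add0r.
Qed.

Lemma integral_const c : integral (iota c).
Proof.
rewrite /integral; have [->|c0] := eqVneq c 0; first by rewrite rmorph0 eqxx.
by rewrite vc // orbT.
Qed.

Lemma integral_eval2 a b W : integral a -> integral b -> integral (eval2 a b W).
Proof.
move=> ia ib; apply: integral_horner => // i.
rewrite coef_map /=; apply: integral_horner => // j.
by rewrite coef_map; apply: integral_const.
Qed.

Lemma v_add_small (a b : L) :
  a != 0 -> (b == 0) || (v a < v b) -> a + b != 0 /\ v (a + b) = v a.
Proof.
move=> a0; have [->|b0 /= lt] := eqVneq b 0; first by rewrite addr0.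
have ab0 : a + b != 0.
  by apply: contraTneq lt => /eqP; rewrite addr_eq0 => /eqP->; rewrite vN ltxx.
split=> //; apply/eqP; rewrite eq_le (vD a0 b0) ?(ltW lt) // andbT leNgt.
apply/negP => gt.
have := @vD (a + b) (- b) (v a + 1).
rewrite addrK oppr_eq0 vN => /(_ ab0 b0 a0); lia.
Qed.

Lemma eval2_rec a b (W : {poly {poly K}}) :
  eval2 a b W = (map_poly iota W`_0).[b] + a * eval2 a b (Poly (behead W)).
Proof.
rewrite /eval2; have {1}-> : W = Poly (behead W) * 'X + (W`_0)%:P.
  apply/polyP => i; rewrite coefD coefMX coefC.
  case: i => [|i] /=; first by rewrite add0r.
  by rewrite addr0 coef_Poly nth_behead.
rewrite rmorphD rmorphM /= map_polyX map_polyC /= hornerMXaddC addrC.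
by rewrite mulrC.
Qed.

(** Modulo a the value is W(0, z), and W(0, z) is a unit here. *)
Lemma v_eval2_residue (a z : L) (W : {poly {poly K}}) : a != 0 -> 0 < v a -> integral z ->
  (map_poly iota W`_0).[z] != 0 -> v (map_poly iota W`_0).[z] = 0 ->
  eval2 a z W != 0 /\ v (eval2 a z W) = 0.
Proof.
move=> a0 va iz q0 vq; rewrite eval2_rec -[X in _ /\ _ = X]vq.
apply: v_add_small => //; rewrite vq mulf_eq0 (negPf a0) /=.
have : integral (eval2 a z (Poly (behead W))).
  by apply: integral_eval2 => //; rewrite /integral (ltW va) orbT.
rewrite /integral; case: eqVneq => //= e0 ve.
by rewrite vM // ltr_wpDr.
Qed.

Lemma eval2_swap a b W : eval2 a b (swapXY W) = eval2 b a W.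
Proof.
have E x y U : eval2 x y U = (map_poly (map_poly iota) U).[x, y].
  rewrite /eval2 map_poly_comp -[in LHS](hornerC x y).
  by rewrite (horner_map (horner_eval y)).
by rewrite !E -swapXY_map horner2_swapXY.
Qed.

Lemma eval2_is_additive a b : {morph eval2 a b : P Q / P + Q}.
Proof. by move=> P Q; rewrite /eval2 rmorphD hornerD. Qed.

Lemma eval2_0 a b : eval2 a b 0 = 0.
Proof. by rewrite /eval2 rmorph0 horner0. Qed.

Lemma eval2_sum a b (I : Type) (r : seq I) (P : pred I) (F : I -> {poly {poly K}}) :
  eval2 a b (\sum_(i <- r | P i) F i) = \sum_(i <- r | P i) eval2 a b (F i).
Proof. exact: (big_morph _ (eval2_is_additive a b) (eval2_0 a b)). Qed.

Lemma eval2_monomial a b c i j :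
  eval2 a b ((c *: 'X^j)%:P * 'X^i) = iota c * b ^+ j * a ^+ i.
Proof.
rewrite /eval2 rmorphM /= map_polyXn map_polyC hornerM hornerXn hornerC /=.
by rewrite /horner_eval map_polyZ map_polyXn hornerZ hornerXn.
Qed.

Lemma poly2_monomials (W : {poly {poly K}}) :
  exists m, W = \sum_(i < m) \sum_(j < m) (W`_i`_j *: 'X^j)%:P * 'X^i.
Proof.
exists (maxn (size W) (sizeY W)); set m := maxn _ _.
have WE : W = \poly_(i < m) W`_i.
  apply/polyP => i; rewrite coef_poly; case: ltnP => // le.
  by rewrite nth_default // (leq_trans _ le) // leq_maxl.
rewrite {1}WE poly_def; apply: eq_bigr => i _.
rewrite -mulr_suml -rmorph_sum /= -mul_polyC; congr (_%:P * _).
rewrite -poly_def; apply/polyP => j; rewrite coef_poly; case: ltnP => // le.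
by rewrite nth_default // (leq_trans _ le) // (leq_trans (max_size_coefXY W i)) ?leq_maxr.
Qed.

(** One chart of the blow-up of the origin: the total transform W(a, a z) of a
    curve of multiplicity k is k times the exceptional curve a = 0 plus a proper
    transform W', which meets the exceptional curve in a divisor of degree at
    most k. *)
Lemma blow_up (W : {poly {poly K}}) k i0 j0 :
  (forall i j, (i + j < k)%N -> W`_i`_j = 0) ->
  (i0 + j0 = k)%N -> W`_i0`_j0 != 0 ->
  exists W' : {poly {poly K}},
    [/\ W'`_0 != 0, (size (W'`_0)%R <= k.+1)%N
      & forall a z, eval2 a (a * z) W = a ^+ k * eval2 a z W'].
Proof.
move=> Wlow ij0 W0; have [m WE] := poly2_monomials W.
exists (\sum_(i < m) \sum_(j < m) (W`_i`_j *: 'X^j)%:P * 'X^(i + j - k)).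
(* W'(0, z) is the initial form of W, dehomogenized: only i + j = k survives. *)
have coef0E j : (\sum_(i < m) \sum_(j < m) (W`_i`_j *: 'X^j)%:P * 'X^(i + j - k))`_0`_j
   = if (j <= k)%N then W`_(k - j)`_j else 0.
  have coefE c i j' l : (((c *: 'X^j')%:P * 'X^i : {poly {poly K}})`_l)`_j =
      c *+ ((j == j') && (l == i)).
    rewrite coefCM coefXn; case: (l == i); last by rewrite mulr0 coef0 andbF.
    by rewrite mulr1 coefZ coefXn andbT mulr_natr.
  rewrite [in RHS]WE !coef_sum.
  rewrite [RHS](_ : _ = \sum_(i < m) if (j <= k)%N then
     (\sum_(j' < m) (W`_i`_j' *: 'X^j')%:P * 'X^i : {poly {poly K}})`_(k - j)`_j else 0);
    last by case: ifP => _; [rewrite ?coef_sum | rewrite big1].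
  apply: eq_bigr => i _; rewrite !coef_sum.
  rewrite [RHS](_ : _ = \sum_(j' < m) if (j <= k)%N then
     (((W`_i`_j' *: 'X^j')%:P * 'X^i : {poly {poly K}})`_(k - j))`_j else 0);
    last by case: ifP => _; [rewrite ?coef_sum | rewrite big1].
  apply: eq_bigr => j' _; rewrite !coefE; case: eqVneq => [->|] /=; last by case: ifP.
  have [lt|gt|<-] := ltngtP (i + j') k.
  - by rewrite Wlow // !mul0rn; case: ifP.
  - have -> : (0%N == i + j' - k)%N = false by lia.
    case: leqP => // le; have -> : (k - j' == i)%N = false by lia.
    by [].
  - by rewrite leq_addl addnK subnn !eqxx.
split.
- apply: contraNneq W0 => q0; have := coef0E j0; rewrite q0 coef0.
  by rewrite -ij0 leq_addl addnK => <-.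
- apply/leq_sizeP => j lt; rewrite coef0E leqNgt lt //.
- move=> a z; rewrite [in LHS]WE !eval2_sum mulr_sumr; apply: eq_bigr => i _.
  rewrite !eval2_sum mulr_sumr; apply: eq_bigr => j _; rewrite !eval2_monomial.
  have [lt|le] := ltnP (i + j) k; first by rewrite Wlow // rmorph0 !mul0r mulr0.
  by rewrite mulrCA -exprD subnKC // exprMn exprD; ring.
Qed.

Lemma jacC a b : jac b a = - jac a b.
Proof. by rewrite /jac; ring. Qed.

(** This is why resolving v by blow-ups consumes the Jacobian: each step divides
    it by the equation of the exceptional curve. *)
Lemma jac_quot a b c : a != 0 -> jac a (b / a - iota c) = jac a b / a.
Proof.
move=> a0; rewrite /jac !(der_add der1, der_add der2) !(derN der1, derN der2).
rewrite der1c der2c !oppr0 !addr0 (der_div der1 _ a0) (der_div der2 _ a0).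
by field.
Qed.

Lemma jac0 a : jac a 0 = 0.
Proof. by rewrite /jac (der0 der1) (der0 der2) !mulr0 subrr. Qed.

Lemma eval2_shift a b c (W : {poly {poly K}}) :
  eval2 a b (map_poly (comp_poly ('X + c%:P)) W) = eval2 a (b + iota c) W.
Proof.
rewrite /eval2 -map_poly_comp; congr _.[_]; apply: eq_map_poly => q /=.
by rewrite /horner_eval map_comp_poly rmorphD /= map_polyX map_polyC horner_comp !hornerE.
Qed.

(** Follow the centre of v through point blow-ups.  When v(a) <= v(b), the curve W
    of multiplicity k0 <= k contributes k0 v(a), and the next pair is (a, b/a - c)
    with c the residue of b/a; the Jacobian loses v(a) and the multiplicity at
    the new centre is at most k0, so induction on v(J) gives
    k0 v(a) + k0 (v(J) - v(a) - 1).  If b/a has no residue in K the process stops,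
    the proper transform is a unit for v, and v(a) <= v(J) - 1 by [vjac]. *)
Lemma vanishing_order (a b : L) (W : {poly {poly K}}) k i0 j0 :
  jac a b != 0 -> 0 < v a -> 0 < v b ->
  (i0 + j0 <= k)%N -> W`_i0`_j0 != 0 ->
  eval2 a b W != 0 /\ v (eval2 a b W) <= k%:Z * (v (jac a b) - 1).
Proof.
have [n le_n] := ubnP `|v (jac a b)|%N.
elim: n => // n IH in a b W k i0 j0 le_n *.
wlog vab : a b W i0 j0 le_n / v a <= v b.
  move=> H J va vb ij W0; have [vab|vab] := leP (v a) (v b).
    exact: (H _ _ _ i0 j0).
  have E : eval2 a b W = eval2 b a (swapXY W) by rewrite eval2_swap.
  have J' : jac b a != 0 by rewrite jacC oppr_eq0.
  have Jv : v (jac b a) = v (jac a b) by rewrite jacC vN.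
  rewrite E -Jv; apply: (H b a (swapXY W) j0 i0) => //; first by rewrite Jv.
  - exact: ltW.
  - by rewrite addnC.
  - by rewrite coef_swapXY.
move=> J va vb ij W0.
have a0 : a != 0.
  by apply: contraNneq J => ->; rewrite jacC jac0 oppr0.
have b0 : b != 0 by apply: contraNneq J => ->; rewrite jac0.
have vJ := vjac J.
(* k0 is the exact multiplicity of W at the origin. *)
pose low d := [exists i : 'I_d.+1, W`_i`_(d - i) != 0].
have exlow : exists d, low d.
  exists (i0 + j0)%N; apply/existsP; exists (inord i0).
  by rewrite inordK ?ltnS ?leq_addr // addKn.
pose k0 := ex_minn exlow.
have [i1 [j1 [ij1 W1 k0k Wlow]]] : exists i1 j1, [/\ (i1 + j1)%N = k0, W`_i1`_j1 != 0,
    (k0 <= k)%N & forall i j, (i + j < k0)%N -> W`_i`_j = 0].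
  have minP d i : (i <= d)%N -> W`_i`_(d - i) != 0 -> low d.
    by move=> le Wi; apply/existsP; exists (inord i); rewrite inordK // ltnS.
  rewrite /k0; case: ex_minnP => d /existsP[i Wi] min.
  exists i, (d - i)%N; split=> //; first by rewrite subnKC // -ltnS.
    apply: leq_trans ij; apply/min/(minP _ i0); first exact: leq_addr.
    by rewrite addKn.
  move=> i' j' lt; apply/eqP; apply: contraTT lt => W'; rewrite -leqNgt.
  by apply/min/(minP _ i'); rewrite ?leq_addr // addKn.
have [W' [W'0 sW' W'E]] := blow_up Wlow ij1 W1.
have bE : b = a * (b / a) by rewrite mulrC divfK.
set z := b / a in bE.
have vz : v z = v b - v a by rewrite vM ?vV ?invr_eq0.
rewrite {1 2}bE W'E.
suff [e0 ve] : eval2 a z W' != 0 /\ v (eval2 a z W') <= k0%:Z * (v (jac a b) - v a - 1).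
  split; first by rewrite mulf_neq0 // expf_neq0.
  rewrite vM ?expf_neq0 // vX // pmulrn -mulrzl; nia.
(* Is the next centre a K-rational point of the exceptional curve? *)
have [[c Hc]|noc] := pselect (exists c, 0 < v (z - iota c) \/ z - iota c = 0).
  have J' : jac a (z - iota c) = jac a b / a by rewrite jac_quot.
  have J'0 : jac a (z - iota c) != 0 by rewrite J' mulf_neq0 ?invr_eq0.
  have vz' : 0 < v (z - iota c).
    by case: Hc => // z0; move: J'0; rewrite z0 jac0 eqxx.
  have vJ' : v (jac a (z - iota c)) = v (jac a b) - v a.
    by rewrite J' vM ?invr_eq0 // vV.
  rewrite -vJ' -[in eval2 _ _ _](subrK (iota c) z) -eval2_shift.
  set W'' := map_poly _ _.
  have W''0 : W''`_0 = W'`_0 \Po ('X + c%:P) by rewrite coef_map_id0 ?comp_poly0.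
  have sW'' : size W''`_0 = size W'`_0 by rewrite W''0 size_comp_poly2 // size_XaddC.
  have vJ'' := vjac J'0.
  apply: (IH _ _ _ _ 0%N (size W''`_0).-1) => //.
  - rewrite vJ'; move: le_n vJ va vb.
    by move: (v (jac a b)) (v a) (v b) => x y u; lia.
  - by rewrite add0n sW''; lia.
  - by rewrite -lead_coefE lead_coef_eq0 -size_poly_eq0 sW'' size_poly_eq0.
have noc' c : z - iota c != 0 /\ v (z - iota c) <= 0.
  by split; [apply/eqP => z0|rewrite leNgt; apply/negP => z0]; apply: noc; exists c; [right|left].
have vz0 : 0 <= v z by rewrite vz subr_ge0.
have [q0 vq] := vres vz0 noc' W'0.
have [e0 ->] := v_eval2_residue a0 va (introT orP (or_intror vz0)) q0 vq.
by split=> //; nia.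
Qed.

(** The logarithmic form da/a db/b is multiplied by the determinant of the
    exponents under a monomial change of coordinates. *)
Lemma jac_monomial a b i j k l : a != 0 -> b != 0 ->
  (j * k = i * l + 1)%N ->
  jac (a ^+ i / b ^+ j) (a ^+ k / b ^+ l) =
    (a ^+ i / b ^+ j) * (a ^+ k / b ^+ l) * (jac a b / (a * b)).
Proof.
move=> a0 b0 det; rewrite /jac !(der_log_quot der1) // !(der_log_quot der2) //.
have detL : j%:R * k%:R = i%:R * l%:R + 1 :> L.
  by rewrite -!natrM det natrD.
set x := _ / _ ; set y := a ^+ k / _.
have natE c n : c *+ n = c * n%:R :> L by rewrite mulr_natr.
rewrite !(natE (D1 a / a)) !(natE (D1 b / b)) !(natE (D2 a / a)) !(natE (D2 b / b)).
rewrite [RHS](_ : _ = x * y * ((D1 a * D2 b - D2 a * D1 b) / (a * b)) *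
  (j%:R * k%:R - i%:R * l%:R)); last by rewrite detL addrAC subrr add0r mulr1.
move: (D1 a) (D1 b) (D2 a) (D2 b) x y (i%:R : L) (j%:R : L) (k%:R : L) (l%:R : L).
by move=> *; field; rewrite a0 b0.
Qed.

(** The multiplicity of a nonzero root c of q is at most the distance between the
    lowest and the highest exponent of q, because the factor X^l0 does not
    vanish at c. *)
Lemma low_coef_shift (q : {poly K}) c l0 : c != 0 -> q != 0 ->
  (forall l, (l < l0)%N -> q`_l = 0) ->
  exists2 j, (j + l0 < size q)%N & (q \Po ('X + c%:P))`_j != 0.
Proof.
move=> c0 q0 qlow; pose r := drop_poly l0 q.
have qE : q = r * 'X^l0.
  rewrite -[LHS](poly_take_drop l0) -[RHS]add0r; congr (_ + _).
  by apply/polyP => i; rewrite coef_take_poly coef0; case: ifP => // /qlow.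
have r0 : r != 0 by apply: contraNneq q0 => r0; rewrite qE r0 mul0r.
pose r' := r \Po ('X + c%:P).
have sr' : size r' = size r by rewrite size_comp_poly2 // size_XaddC.
have exj : exists j, r'`_j != 0.
  exists (size r').-1; rewrite -lead_coefE lead_coef_eq0.
  by rewrite -size_poly_eq0 sr' size_poly_eq0.
case: (ex_minnP exj) => j rj minj.
have jlt : (j < size r)%N.
  by rewrite -sr' ltnNge; apply: contra rj => le; rewrite nth_default.
exists j; first by rewrite addnC -ltn_subRL -size_drop_poly.
rewrite qE comp_polyM comp_Xn_poly mulrC coefM (bigD1 ord0) //= subn0 big1.
  by rewrite addr0 mulf_neq0 // -horner_coef0 horner_exp !hornerE expf_neq0.
move=> i i0; rewrite mulrC; case: (eqVneq r'`_(j - i) 0) => [->|/minj]; first by rewrite mul0r.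
by have := ltn_ord i; move: i0; rewrite -val_eqE /=; lia.
Qed.

(** The monomials p = f^beta / g^alpha and t = f^b / g^n have exponents of
    determinant 1, so f = p^-n t^alpha and g = p^-b t^beta, and a monomial of P
    of weight w becomes p^-w times a power of t.  Clearing p^-M leaves a
    polynomial W; W(0, t) comes from the edge of weight M of the Newton polygon
    of P.  On that edge the exponents of f and g are b l - beta M and
    alpha M - n l, where l is the exponent of t; that they are not negative is
    the last clause, and it confines l to an interval of length M / (n b). *)
Lemma toric_chart (f g : L) (n b alpha beta : nat) (P : {mpoly K[2]}) :
  f != 0 -> g != 0 ->
  (b * alpha = n * beta + 1)%N ->
  let wt (m : 'X_{1..2}) := (n * m ord0 + b * m ord_max)%N in
  let M := \max_(m <- msupp P) wt m in
  (0 < M)%N ->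
  exists W : {poly {poly K}},
    [/\ eval2 (f ^+ beta / g ^+ alpha) (f ^+ b / g ^+ n) W =
        mmap iota (at2 f g) P * (f ^+ beta / g ^+ alpha) ^+ M,
       W`_0 != 0
     & forall l, (W`_0)`_l != 0 ->
        (beta * M <= b * l)%N /\ (n * l <= alpha * M)%N].
Proof.
move=> f0 g0 det wt M M0.
set p := _ / _; set t := _ / _.
have wtM m : m \in msupp P -> (wt m <= M)%N by move=> mP; apply: leq_bigmax_seq.
pose l (m : 'X_{1..2}) := (alpha * m ord0 + beta * m ord_max)%N.
exists (\sum_(m <- msupp P) (P@_m *: 'X^(l m))%:P * 'X^(M - wt m)).
have fE : f * p ^+ n = t ^+ alpha.
  rewrite /p /t !expr_div_n -!exprM mulrA -exprS [(g ^+ _)]lock [(n * _)%N]mulnC -lock.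
  by congr (_ ^+ _ / _ ^+ _); lia.
have gE : g * p ^+ b = t ^+ beta.
  rewrite /p /t !expr_div_n -!exprM [(alpha * b)%N]mulnC det addn1 exprS.
  rewrite [(beta * b)%N]mulnC; move: (expf_neq0 (n * beta) g0).
  by move: (g ^+ _) (f ^+ _) => x y x0; field; rewrite x0 g0.
have coefE j : ((\sum_(m <- msupp P) (P@_m *: 'X^(l m))%:P * 'X^(M - wt m)
      : {poly {poly K}})`_0)`_j =
    \sum_(m <- msupp P) P@_m *+ ((j == l m) && (wt m == M)).
  rewrite !coef_sum big_seq [RHS]big_seq; apply: eq_bigr => m mP.
  rewrite coefCM coefXn; have -> : (0%N == M - wt m)%N = (wt m == M).
    by have := wtM m mP; lia.
  case: (wt m == M); last by rewrite mulr0 coef0 andbF.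
  by rewrite mulr1 coefZ coefXn andbT mulr_natr.
(* The determinant being 1, the weight and the exponent of t determine m. *)
have recover m : (b * l m)%N = (m ord0 + beta * wt m)%N /\
    (alpha * wt m)%N = (n * l m + m ord_max)%N.
  by rewrite /l /wt; split; nia.
split.
- rewrite eval2_sum /mmap mulr_suml big_seq [RHS]big_seq; apply: eq_bigr => m mP.
  have tl : t ^+ l m = f ^+ m ord0 * g ^+ m ord_max * p ^+ wt m.
    rewrite /l /wt; move: p t fE gE => u w fu gu.
    by rewrite !exprD !exprM -fu -gu !exprMn mulrACA.
  by rewrite eval2_monomial mmap1_at2 tl -!mulrA -!exprD subnKC // wtM.
- have [m mP mM] := bigmax_seq_attained M0; rewrite -/M in mM.
  apply/eqP => /(congr1 (fun q : {poly K} => q`_(l m))); rewrite coefE coef0.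
  rewrite (bigD1_seq m) ?msupp_uniq //= mM !eqxx big_seq_cond big1 ?addr0.
    by apply/eqP; rewrite -mcoeff_msupp.
  move=> m' /andP[_ neq]; case: eqP => //= el; case: eqP => //= em; case/eqP: neq.
  have [e1 e2] := recover m; have [e3 e4] := recover m'.
  by apply: mnm2P; nia.
- move=> j; rewrite coefE => nz.
  have /hasP[m mP /andP[/eqP-> /eqP<-]] : has (fun m => (j == l m) && (wt m == M)) (msupp P).
    apply: contraNT nz => /hasPn no; rewrite big_seq big1 // => m /no.
    by move/negbTE->.
  by have [-> ->] := recover m; rewrite leq_addl leq_addr.
Qed.

(** Both parts come from computing the order of W(p, t) along v in two ways.  It
    is at least e M, because P(f, g) has no pole.  If t had no residue in K, then
    W(p, t) would be a unit.  Otherwise [vanishing_order] at the point (0, c)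
    bounds it by k (e (n + b + 1) - 1) with n b k <= M. *)
Theorem degree_divisibility (f g : L) (n b e : nat) (P : {mpoly K[2]}) :
  (0 < n)%N -> (0 < b)%N -> (0 < e)%N -> coprime n b ->
  v f = - (n * e)%:Z -> v g = - (b * e)%:Z -> f != 0 -> g != 0 ->
  jac f g != 0 -> v (jac f g) <= 0 ->
  (exists2 m, m \in msupp P & m != 0%MM) ->
  mmap iota (at2 f g) P = 0 \/ 0 <= v (mmap iota (at2 f g) P) ->
  (n = 1%N \/ b = 1%N) /\
  exists2 c, c != 0 & 0 < v (f ^+ b / g ^+ n - iota c).
Proof.
move=> n0 b0 e0 cop vf vg f0 g0 J0 vJ [m mP m0] vP.
have [alpha [beta det]] : exists alpha beta, (b * alpha = n * beta + 1)%N.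
  have [[alpha beta] /= [det _]] : exists uv : nat * nat, (uv.1 * b = uv.2 * n + 1)%N /\ True.
    by case: (egcdnP n b0) => u w det _; exists (u, w); rewrite /= det gcdnC (eqP cop).
  by exists alpha, beta; lia.
pose wt (m : 'X_{1..2}) := (n * m ord0 + b * m ord_max)%N.
pose M := \max_(m <- msupp P) wt m.
have M0 : (0 < M)%N.
  apply: (@leq_trans (wt m)); last exact: leq_bigmax_seq.
  rewrite lt0n; apply: contraNneq m0 => /eqP.
  rewrite /wt addn_eq0 !muln_eq0 (gtn_eqF n0) (gtn_eqF b0) /=.
  by case/andP=> /eqP e1 /eqP e2; apply/eqP/mnm2P; rewrite mnm0E.
have [W [WE W0 supW]] := toric_chart f0 g0 det M0; rewrite -/wt -/M in WE supW.
set p := f ^+ beta / _ in WE; set t := f ^+ b / _ in WE *.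
have p0 : p != 0 by rewrite mulf_neq0 ?invr_eq0 ?expf_neq0.
have t0 : t != 0 by rewrite mulf_neq0 ?invr_eq0 ?expf_neq0.
have zE (x : int) k : x *+ k = x * k%:Z by rewrite -mulr_natr natz.
have detZ : b%:Z * alpha%:Z = n%:Z * beta%:Z + 1 by rewrite -!PoszM det PoszD.
have vp : v p = e.
  rewrite vM ?invr_eq0 ?expf_neq0 // vV ?expf_neq0 // !vX // vf vg !zE.
  rewrite !PoszM (_ : _ - _ = e%:Z * (b%:Z * alpha%:Z - n%:Z * beta%:Z)); last by ring.
  by rewrite detZ addrAC subrr add0r mulr1.
have vt : v t = 0.
  rewrite vM ?invr_eq0 ?expf_neq0 // vV ?expf_neq0 // !vX // vf vg !zE.
  by rewrite !PoszM; ring.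
have jacE : jac p t = p * t * (jac f g / (f * g)) 
  by apply: jac_monomial => //; rewrite mulnC det mulnC.
have fg0 : f * g != 0 by rewrite mulf_neq0.
have q0 : jac f g / (f * g) != 0 by rewrite mulf_neq0 ?invr_eq0.
have pt0 : p * t != 0 by rewrite mulf_neq0.
have jac_pt : jac p t != 0 by rewrite jacE mulf_neq0.
have vjac_pt : v (jac p t) <= (e * (n + b + 1))%:Z.
  rewrite jacE (vM pt0 q0) (vM p0 t0) vM ?invr_eq0 // (vV fg0) (vM f0 g0).
  rewrite vp vt vf vg !(PoszM, PoszD).
  by rewrite (_ : _ + _ = e%:Z * (n%:Z + b%:Z + 1) + v (jac f g)) ?gerDl //; ring.
have vW : eval2 p t W != 0 -> (e * M)%:Z <= v (eval2 p t W).
  rewrite WE mulf_eq0 negb_or => /andP[P0 pM0].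
  case: vP => [/eqP|vP]; first by rewrite (negPf P0).
  by rewrite vM // vX // vp zE PoszM lerDr.
have [[c Hc]|noc] := pselect (exists c, 0 < v (t - iota c) \/ t - iota c = 0); last first.
  have noc' c : t - iota c != 0 /\ v (t - iota c) <= 0.
    by split; [apply/eqP => z0|rewrite leNgt; apply/negP => z0]; apply: noc; exists c; [right|left].
  have vt0 : 0 <= v t by rewrite vt.
  have [W0t vq] := vres vt0 noc' W0.
  have [|Wt0 vWt] := v_eval2_residue p0 _ (introT orP (or_intror vt0)) W0t vq.
    by rewrite vp.
  by have := vW Wt0; rewrite vWt lez_nat leqNgt muln_gt0 e0 M0.
have jac_s : jac p (t - iota c) = jac p t.
  rewrite /jac (der_add der1) (der_add der2) (derN der1) (derN der2).
  by rewrite der1c der2c !subr0.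
have s0 : t - iota c != 0.
  by apply: contraNneq jac_pt => s0; rewrite -jac_s s0 jac0.
have vs : 0 < v (t - iota c) by case: Hc => // /eqP; rewrite (negPf s0).
have c0 : c != 0 by apply: contraTneq vs => ->; rewrite rmorph0 subr0 vt.
split; last by exists c.
have [l0 [sl0 l0low]] : exists l0, (W`_0)`_l0 != 0 /\ forall l, (l < l0)%N -> (W`_0)`_l = 0.
  have ex : exists l, (W`_0)`_l != 0.
    by exists (size W`_0).-1; rewrite -lead_coefE lead_coef_eq0.
  case: (ex_minnP ex) => l0 sl0 min; exists l0; split=> // l lt.
  by apply/eqP; apply: contraTT lt => /min; rewrite -leqNgt.
have [j jlt Wj] := low_coef_shift c0 W0 l0low.
have [lo _] := supW _ sl0.
have lead0 : (W`_0)`_(size W`_0).-1 != 0 by rewrite -lead_coefE lead_coef_eq0.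
have [_ hi] := supW _ lead0.
have kM : (n * b * j <= M)%N.
  have h1 : (n * b * (j + l0) <= b * (alpha * M))%N.
    rewrite [(n * b)%N]mulnC -mulnA leq_mul2l; apply/orP; right.
    by apply: leq_trans hi; rewrite leq_mul2l -ltnS (ltn_predK jlt) jlt orbT.
  have h2 : (n * (beta * M) <= n * (b * l0))%N by rewrite leq_mul2l lo orbT.
  move: h1; rewrite mulnA det mulnDl mul1n mulnDr => h1.
  rewrite -(leq_add2l (n * (beta * M))); apply: leq_trans (leq_trans h1 _).
    by rewrite addnC leq_add2l -mulnA.
  by rewrite mulnA.
have [] := @vanishing_order p (t - iota c) (map_poly (comp_poly ('X + c%:P)) W) j 0 j.
- by rewrite jac_s.
- by rewrite vp.
- exact: vs.
- by [].
- by rewrite coef_map_id0 ?comp_poly0.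
rewrite eval2_shift subrK jac_s => /vW le1 le2.
(* Multiply e M <= k (e (n + b + 1) - 1) by n b and cancel M. *)
have ineq : (n * b < n + b + 1)%N.
  move: kM (le_trans le1 le2) vjac_pt M0 e0 n0 b0; clear.
  move: (v (jac p t)) => u kM le ule M0 e0 n0 b0.
  have le' : e%:Z * M%:Z <= j%:Z * ((e * (n + b + 1))%:Z - 1).
    rewrite -PoszM; apply: (le_trans le); apply: ler_wpM2l => //.
    by rewrite lerD2r.
  have E1 : 0 <= (e * (n + b + 1))%:Z - 1 :> int.
    have : (0 < e * (n + b + 1))%N by rewrite muln_gt0 e0 addn1.
    by clear; move: (e * _)%N => E; lia.
  have le2 : M%:Z * (e * (n * b))%:Z <= M%:Z * ((e * (n + b + 1))%:Z - 1).
    have kMz : (n * b * j)%:Z <= M%:Z by rewrite lez_nat.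
    apply: le_trans (ler_wpM2r E1 kMz).
    rewrite (_ : M%:Z * _ = (n * b)%:Z * (e%:Z * M%:Z)); last by rewrite !PoszM; ring.
    by rewrite [(n * b * j)%:Z]PoszM -[X in _ <= X]mulrA ler_wpM2l.
  move: le2; rewrite ler_pM2l ?ltz_nat // => le2.
  rewrite -(ltn_pmul2l e0) -ltz_nat (le_lt_trans le2) //.
  by rewrite ltrBlDr ltrDl.
have [//|n1] := eqVneq n 1%N; first by left.
have [//|b1] := eqVneq b 1%N; first by right.
(* The only solution with both factors positive is n = b = 2, not coprime. *)
have nb : ((n - 1) * (b - 1) <= 1)%N by clear -ineq n0 b0; nia.
have [n2 b2] : n = 2%N /\ b = 2%N by clear -nb n0 b0 n1 b1; nia.
by move: cop; rewrite n2 b2.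
Qed.

End BlowUp.

(** * Derivations of a fraction field *)

Section Fractions.
Variable R : idomainType.
Local Notation F := {fraction R}.
Local Notation "x %:F" := (@tofrac R x).

Lemma fraction_quotient (z : F) : exists nd : R * R, nd.2 != 0 /\ z = nd.1%:F / nd.2%:F.
Proof.
elim/quotW: z => x; exists (\n_x, \d_x); split=> /=; first exact: denom_ratioP.
have d0 : (\d_x)%:F != 0 by rewrite tofrac_eq0 denom_ratioP.
apply: (mulIf d0); rewrite divfK //.
unlock tofrac; rewrite -[LHS]FracField.pi_mul; apply/eqmodP => /=.
rewrite FracField.equivfE /FracField.mulf /= !numden_Ratio ?mulr1 ?oner_neq0 ?denom_ratioP //.
by rewrite mulrC.
Qed.

Definition fracnd z := projT1 (cid (fraction_quotient z)).
Definition fracn z := (fracnd z).1.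
Definition fracd z := (fracnd z).2.

Lemma fracd_neq0 z : fracd z != 0.
Proof. by rewrite /fracd /fracnd; case: cid => nd [] /=. Qed.

Lemma fracE z : z = (fracn z)%:F / (fracd z)%:F.
Proof. by rewrite /fracd /fracn /fracnd; case: cid => nd [] /=. Qed.

Lemma fracn_neq0 z : z != 0 -> fracn z != 0.
Proof. by apply: contraNneq => n0; rewrite (fracE z) n0 rmorph0 mul0r. Qed.

Lemma frac_eq a b c d : b != 0 -> d != 0 ->
  (a%:F / b%:F == c%:F / d%:F) = (a * d == c * b).
Proof.
by move=> b0 d0; rewrite eqr_div ?tofrac_eq0 // -!rmorphM /= tofrac_eq.
Qed.

Section Derivation.
Variable D : R -> R.
Hypothesis derD : derivation D.

(** The quotient rule applied to one chosen representation of z;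
    [fracder_quot] shows that the choice does not matter. *)
Definition fracder z : F :=
  (D (fracn z) * fracd z - fracn z * D (fracd z))%:F / (fracd z ^+ 2)%:F.

Lemma fracder_quot a b : b != 0 ->
  fracder (a%:F / b%:F) = (D a * b - a * D b)%:F / (b ^+ 2)%:F.
Proof.
move=> b0; set z := _ / _; have d0 := fracd_neq0 z.
have /eqP := fracE z; rewrite {1}/z frac_eq // => /eqP ad.
apply/eqP; rewrite frac_eq ?expf_neq0 //; apply/eqP.
have := congr1 D ad; case: derD => _ M; rewrite !M => Dad.
move: (D a) (D b) (D (fracn z)) (D (fracd z)) ad Dad d0 => a' b' n' d'.
move: (fracn z) (fracd z) => n d ad Dad d0.
apply/eqP; rewrite -subr_eq0 (_ : _ - _ = b * d * ((n' * b + n * b') - (a' * d + a * d'))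
  + (a * d - n * b) * (b * d' + b' * d)); last by ring.
by rewrite -Dad ad !subrr mulr0 mul0r addr0.
Qed.

Lemma fracder_derivation : derivation fracder.
Proof.
case: derD => A M.
split=> x y; have [x0 y0] := (fracd_neq0 x, fracd_neq0 y); rewrite (fracE x) (fracE y).
all: move: (fracn x) (fracn y) (fracd x) (fracd y) x0 y0 => a c b d b0 d0.
- rewrite addf_div ?tofrac_eq0 // -!rmorphM -rmorphD /= !fracder_quot ?mulf_neq0 //.
  rewrite addf_div ?tofrac_eq0 ?expf_neq0 // -!rmorphM -rmorphD /=.
  apply/eqP; rewrite frac_eq ?mulf_neq0 ?expf_neq0 //; apply/eqP.
  by rewrite !A !M; ring.
- rewrite mulf_div -!rmorphM /= !fracder_quot ?mulf_neq0 // !mulf_div -!rmorphM /=.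
  rewrite addf_div ?tofrac_eq0 ?mulf_neq0 ?expf_neq0 // -!rmorphM -rmorphD /=.
  apply/eqP; rewrite frac_eq ?mulf_neq0 ?expf_neq0 //; apply/eqP.
  by rewrite !M; ring.
Qed.

Lemma fracder_tofrac a : fracder a%:F = (D a)%:F.
Proof.
have D1 : D 1 = 0.
  by case: derD => _ M; apply: (addrI (D 1)); rewrite addr0 -{3}[1]mulr1 M mulr1 mul1r.
rewrite -[in LHS](divr1 a%:F) -[in LHS](rmorph1 (@tofrac R)) fracder_quot ?oner_neq0 //.
by rewrite D1 mulr0 subr0 mulr1 expr1n rmorph1 divr1.
Qed.

End Derivation.
End Fractions.

(** * The valuation - deg_y on K(x, y) *)

Local Notation "x %:F" := (@tofrac _ x).

Lemma expr_quot (F : fieldType) (x y : F) i k : y != 0 -> (i <= k)%N ->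
  (x / y) ^+ i = x ^+ i * y ^+ (k - i) / y ^+ k.
Proof.
move=> y0 ik; rewrite -{2}(subnKC ik) exprD expr_div_n -mulf_div divff ?mulr1 //.
by rewrite expf_neq0.
Qed.

Section DegreeValuation.

Variable K : fieldType.
Local Notation B := {poly {poly K}}.
Local Notation L := {fraction B}.

Definition constF (c : K) : L := (c%:P%:P)%:F.
HB.instance Definition _ := GRing.RMorphism.copy constF ((@tofrac B) \o (polyC \o polyC)).

(** In [{poly {poly K}}] the outer variable is y and the inner one is x. *)
Definition ddx : B -> B := map_poly (@deriv K).
Definition ddy : B -> B := @deriv {poly K}.

Lemma ddy_derivation : derivation ddy.
Proof. by split=> p q; rewrite /ddy ?derivD ?derivM. Qed.

Lemma ddx_derivation : derivation ddx.
Proof.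
split=> p q; first by rewrite /ddx raddfD.
apply/polyP => i; rewrite coefD coef_map !coefM /= raddf_sum -big_split.
by apply: eq_bigr => j _; rewrite /ddx !coef_map /= derivM.
Qed.

Definition Dx : L -> L := fracder ddx.
Definition Dy : L -> L := fracder ddy.
Lemma Dx_derivation : derivation Dx.
Proof. exact/fracder_derivation/ddx_derivation. Qed.

Lemma Dy_derivation : derivation Dy.
Proof. exact/fracder_derivation/ddy_derivation. Qed.

Definition negdeg (z : L) : int := (size (fracd z))%:Z - (size (fracn z))%:Z.

Lemma negdeg_quot (a b : B) : a != 0 -> b != 0 ->
  negdeg (a%:F / b%:F) = (size b)%:Z - (size a)%:Z.
Proof.
move=> a0 b0; rewrite /negdeg; set z := _ / _.
have z0 : z != 0 by rewrite mulf_neq0 ?invr_eq0 ?tofrac_eq0.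
have [n0 d0] := (fracn_neq0 z0, fracd_neq0 z).
have /eqP := fracE z; rewrite {1}/z frac_eq // => /eqP /(congr1 (size \o val)) /=.
rewrite !size_mul //; move: a0 b0 n0 d0; rewrite -!size_poly_gt0.
by move: (size _) (size _) (size _) (size _) => *; lia.
Qed.

Lemma quot_neq0 (a b : B) : a%:F / b%:F != 0 -> a != 0.
Proof. by apply: contraNneq => ->; rewrite rmorph0 mul0r. Qed.

Lemma negdegM (a b : L) : a != 0 -> b != 0 -> negdeg (a * b) = negdeg a + negdeg b.
Proof.
rewrite (fracE a) (fracE b).
move: (fracn a) (fracn b) (fracd a) (fracd b) (fracd_neq0 a) (fracd_neq0 b).
move=> n m d e d0 e0 /quot_neq0 n0 /quot_neq0 m0.
rewrite mulf_div -!rmorphM !negdeg_quot ?mulf_neq0 // !size_mul //.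
move: d0 e0 n0 m0; rewrite -!size_poly_gt0.
by move: (size _) (size _) (size _) (size _) => *; lia.
Qed.

Lemma negdegD (a b : L) (m : int) : a != 0 -> b != 0 -> a + b != 0 ->
  m <= negdeg a -> m <= negdeg b -> m <= negdeg (a + b).
Proof.
rewrite (fracE a) (fracE b).
move: (fracn a) (fracn b) (fracd a) (fracd b) (fracd_neq0 a) (fracd_neq0 b).
move=> n p d e d0 e0 /quot_neq0 n0 /quot_neq0 p0.
rewrite addf_div ?tofrac_eq0 // -!rmorphM -rmorphD /= => /quot_neq0 s0.
rewrite !negdeg_quot ?mulf_neq0 // size_mul //.
have := size_polyD (n * e) (p * d); rewrite !size_mul //.
move: d0 e0 n0 p0 s0; rewrite -!size_poly_gt0.
by move: (size _) (size _) (size _) (size _) (size _) => *; lia.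
Qed.

Lemma negdeg_constF (c : K) : c != 0 -> negdeg (constF c) = 0.
Proof.
move=> c0; rewrite /constF -[X in negdeg X]divr1 -(rmorph1 (@tofrac B)).
by rewrite negdeg_quot ?oner_neq0 ?polyC_eq0 // size_poly1 size_polyC polyC_eq0 c0.
Qed.

Lemma Dx_const c : Dx (constF c) = 0.
Proof.
rewrite /Dx /constF fracder_tofrac; last exact: ddx_derivation.
by rewrite /ddx map_polyC /= derivC rmorph0.
Qed.

Lemma Dy_const c : Dy (constF c) = 0.
Proof.
rewrite /Dy /constF fracder_tofrac; last exact: ddy_derivation.
by rewrite /ddy derivC rmorph0.
Qed.

(** Differentiating in x does not raise the degree in y and differentiating in y
    lowers it by at least one. *)
Lemma negdeg_jac (a b : L) : jac Dx Dy a b != 0 ->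
  negdeg a + negdeg b + 1 <= negdeg (jac Dx Dy a b).
Proof.
rewrite (fracE a) (fracE b).
move: (fracn a) (fracn b) (fracd a) (fracd b) (fracd_neq0 a) (fracd_neq0 b).
move=> n p d e d0 e0.
have [->|n0] := eqVneq n 0.
  rewrite rmorph0 mul0r /jac (der0 Dx_derivation).
  by rewrite (der0 Dy_derivation) !mul0r subrr eqxx.
have [->|p0] := eqVneq p 0.
  rewrite rmorph0 mul0r /jac (der0 Dx_derivation).
  by rewrite (der0 Dy_derivation) !mulr0 subrr eqxx.
rewrite /jac /Dx /Dy !(fracder_quot ddx_derivation) // !(fracder_quot ddy_derivation) //.
have szx r t : (size (ddx r * t - r * ddx t)%R <= (size r + size t).-1)%N.
  apply: leq_trans (size_polyD _ _) _; rewrite size_polyN geq_max.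
  have szdx u : (size (ddx u) <= size u)%N by exact: size_poly.
  apply/andP; split; apply: leq_trans (size_polyMleq _ _) _; rewrite -!subn1 leq_sub2r //.
    by rewrite leq_add2r.
  by rewrite leq_add2l.
have szy r t : r != 0 -> t != 0 ->
    (size (ddy r * t - r * ddy t)%R <= (size r + size t).-2)%N.
  rewrite -!size_poly_gt0 => r0 t0.
  apply: leq_trans (size_polyD _ _) _; rewrite size_polyN geq_max.
  have szdy u : (size (ddy u) <= (size u).-1)%N by exact: size_poly.
  apply/andP; split; apply: leq_trans (size_polyMleq _ _) _; have := szdy r; have := szdy t;
    by move: (size (ddy r)) (size (ddy t)) (size r) (size t) r0 t0 => *; lia.
set x1 := ddx n * d - _; set y2 := ddy p * e - _.
set y1 := ddy n * d - _; set x2 := ddx p * e - _.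
rewrite !mulf_div -!rmorphM /= -mulrBl -rmorphB /= => /quot_neq0 N0.
rewrite !negdeg_quot ?mulf_neq0 ?expf_neq0 //.
have : (size (x1 * y2 - y1 * x2)%R <= (size n + size d + size p + size e - 4))%N.
  have := szx n d; have := szx p e; have := szy n d n0 d0; have := szy p e p0 e0.
  rewrite -/x1 -/x2 -/y1 -/y2 => h1 h2 h3 h4.
  move: n0 d0 p0 e0; rewrite -!size_poly_gt0 => n0 d0 p0 e0.
  apply: leq_trans (size_polyD _ _) _; rewrite size_polyN geq_max.
  apply/andP; split; apply: leq_trans (size_polyMleq _ _) _; move: h1 h2 h3 h4 n0 d0 p0 e0;
    by move: (size x1) (size x2) (size y1) (size y2) (size n) (size d) (size p) (size e) => *; lia.
rewrite !expr2 !size_mul ?mulf_neq0 //.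
move: n0 d0 p0 e0; rewrite -!size_poly_gt0.
by move: (size (x1 * y2 - y1 * x2)) (size n) (size d) (size p) (size e) => *; lia.
Qed.

(** The field K is algebraically closed in K(x): if alpha / beta is a root of q,
    then in lowest terms a / b the denominator b divides the leading term of the
    homogenized equation, hence is constant, and a polynomial a that is not
    constant satisfies no equation over K. *)
Lemma homogenized_neq0 (q alpha beta : {poly K}) : q != 0 -> beta != 0 ->
  (forall c, alpha != c *: beta) ->
  \sum_(i < size q) q`_i *: (alpha ^+ i * beta ^+ ((size q).-1 - i)) != 0.
Proof.
move=> q0 beta0 nprop; apply/eqP => h0.
pose g := gcdp alpha beta.
have g0 : g != 0 by rewrite gcdp_eq0 negb_and beta0 orbT.
have [aE bE] : alpha = (alpha %/ g) * g /\ beta = (beta %/ g) * g.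
  by rewrite !divpK ?dvdp_gcdl ?dvdp_gcdr.
have := coprimep_div_gcd (introT orP (or_intror beta0) : (alpha != 0) || (beta != 0)).
rewrite -/g; move: (alpha %/ g) (beta %/ g) aE bE => a b aE bE cop.
have [k sq] : exists k, size q = k.+1.
  by exists (size q).-1; rewrite prednK // size_poly_gt0.
have qk : q`_k != 0 by move: q0; rewrite -lead_coef_eq0 lead_coefE sq.
move: h0; rewrite sq /= => h0.
have h1 : \sum_(i < k.+1) q`_i *: (a ^+ i * b ^+ (k - i)) = 0.
  apply: (mulIf (expf_neq0 k g0)); rewrite mul0r -[RHS]h0 mulr_suml.
  apply: eq_bigr => i _; rewrite aE bE -scalerAl !exprMn mulrACA -exprD.
  by rewrite subnKC // -ltnS.
have bdvd : b %| a ^+ k.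
  move: h1; rewrite big_ord_recr /= subnn mulr1 addrC => /eqP; rewrite addr_eq0 => /eqP h1.
  rewrite -(dvdpZr _ _ qk) h1 dvdpNr.
  apply: (big_ind (fun p => b %| p)) => [|x y|i _]; [exact: dvdp0|exact: dvdp_add|].
  rewrite -mul_polyC; apply/dvdp_mull/dvdp_mull.
  by rewrite -(subnSK (ltn_ord i)) exprS dvdp_mulIl.
have sb : size b = 1%N.
  apply/eqP; rewrite -coprimepp; apply: coprimep_dvdl bdvd _.
  by apply: coprimep_expr; rewrite coprimep_sym.
have [b' b'0 bE'] : exists2 b', b' != 0 & b = b'%:P.
  by move/eqP/size_poly1P: sb => [b' b'0 ->]; exists b'.
have h2 : (\poly_(i < k.+1) (q`_i * b' ^+ (k - i))) \Po a = 0.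
  rewrite -[RHS]h1 poly_def rmorph_sum; apply: eq_bigr => i _ /=.
  by rewrite comp_polyZ comp_Xn_poly bE' -polyC_exp [a ^+ i * _]mulrC mul_polyC scalerA.
have sa : (size a <= 1)%N.
  rewrite leqNgt; apply/negP => sa; move/eqP: h2; rewrite comp_poly_eq0 //.
  apply/negP; apply: contraNneq qk => /(congr1 (fun p : {poly K} => p`_k)).
  by rewrite coef0 coef_poly ltnSn subnn mulr1 => ->.
have /negP[] := nprop (a`_0 / b').
by rewrite aE bE (size1_polyC sa) bE' coefC eqxx -mul_polyC mulrA -polyCM divfK.
Qed.

(** The residue of n / d is the quotient of the leading coefficients in K(x), so
    [homogenized_neq0] applies to the leading coefficient of the homogenization
    of q at n, d. *)
Lemma residue_transcendental (z : L) : 0 <= negdeg z ->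
  (forall c, z - constF c != 0 /\ negdeg (z - constF c) <= 0) ->
  forall q : {poly K}, q != 0 ->
  (map_poly constF q).[z] != 0 /\ negdeg (map_poly constF q).[z] = 0.
Proof.
rewrite (fracE z); move: (fracn z) (fracd z) (fracd_neq0 z) => n d d0 vz noc q q0.
have dF0 : d%:F != 0 by rewrite tofrac_eq0.
have subE c : n%:F / d%:F - constF c = (n - c%:P *: d)%:F / d%:F.
  by rewrite rmorphB mulrBl /constF -mul_polyC rmorphM /= mulfK.
have n0 : n != 0.
  by have [+ _] := noc 0; rewrite subE scale0r subr0 => /quot_neq0.
have sz : size n = size d.
  have [_] := noc 0; rewrite subE scale0r subr0; move: vz; rewrite negdeg_quot //.
  by move: (size n) (size d) => *; lia.
set k := (size q).-1.
pose H := \sum_(i < size q) (q`_i)%:P *: (n ^+ i * d ^+ (k - i)).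
have qE : (map_poly constF q).[n%:F / d%:F] = H%:F / (d ^+ k)%:F.
  rewrite horner_coef size_map_poly rmorph_sum mulr_suml; apply: eq_bigr => i _.
  have ik : (i <= k)%N by rewrite -ltnS /k prednK // size_poly_gt0.
  rewrite coef_map (expr_quot _ dF0 ik) mulrA -mul_polyC.
  by rewrite !rmorphM !rmorphXn.
have lead_pow (r : B) i : r != 0 -> size (r ^+ i) = (i * (size r).-1).+1 /\
    (r ^+ i)`_(i * (size r).-1) = lead_coef r ^+ i.
  move=> r0; have := size_exp r i; have := lead_coef_exp r i.
  rewrite lead_coefE => <- /esym; rewrite mulnC => ->; split=> //.
  by rewrite prednK // size_poly_gt0 expf_neq0.
set s := (size d).-1.
have Hk : H`_(k * s) = \sum_(i < size q) q`_i *: (lead_coef n ^+ i * lead_coef d ^+ (k - i)).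
  rewrite coef_sum; apply: eq_bigr => i _; rewrite coefZ mul_polyC; congr (_ *: _).
  have [sn ln] := lead_pow n i n0; have [sd ld] := lead_pow d (k - i)%N d0.
  have -> : (k * s = (size (n ^+ i * d ^+ (k - i))%R).-1)%N.
    rewrite size_mul ?expf_neq0 // sn sd sz addnS /= -mulnDl subnKC //.
    by rewrite -ltnS prednK // size_poly_gt0.
  by rewrite -lead_coefE lead_coefM !lead_coef_exp.
have Hn : H`_(k * s) != 0.
  rewrite Hk homogenized_neq0 ?lead_coef_eq0 // => c; apply/negP => /eqP lc.
  have [/[!subE] /quot_neq0 m0 vm] := noc c.
  move: vm; rewrite negdeg_quot // subr_le0 lez_nat leqNgt => /negP[].
  rewrite -(prednK (n := size d)) ?size_poly_gt0 // ltnS.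
  apply/leq_sizeP => j; rewrite leq_eqVlt => /orP[/eqP <-|lt].
    rewrite coefB coefZ -{1}sz -!lead_coefE lc.
    by rewrite mul_polyC subrr.
  by rewrite coefB coefZ !nth_default ?mulr0 ?subrr // ?sz -[size d]prednK ?size_poly_gt0.
have H0 : H != 0 by apply: contraNneq Hn => ->; rewrite coef0.
have sH : size H = size (d ^+ k).
  have [-> _] := lead_pow d k d0; apply/eqP; rewrite eqn_leq ltnNge andbC.
  rewrite (contra _ Hn); last by move=> le; rewrite nth_default.
  apply: leq_trans (size_sum _ _ _) _; apply/bigmax_leqP => i _.
  apply: leq_trans (size_scale_leq _ _) _; rewrite size_mul ?expf_neq0 //.
  have [-> _] := lead_pow n i n0; have [-> _] := lead_pow d (k - i)%N d0.
  rewrite sz addnS /= addSn ltnS -mulnDl subnKC //.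
  by rewrite -ltnS prednK // size_poly_gt0.
rewrite qE mulf_neq0 ?invr_eq0 ?tofrac_eq0 ?expf_neq0 //; split=> //.
by rewrite negdeg_quot ?expf_neq0 // sH subrr.
Qed.

End DegreeValuation.

(** * Reducing a pair of coordinates *)

Section Reduction.

Variable K : fieldType.
Local Notation B := {poly {poly K}}.
Local Notation L := {fraction B}.

Definition constB (c : K) : B := c%:P%:P.
HB.instance Definition _ := GRing.RMorphism.copy constB (@polyC {poly K} \o @polyC K).

Definition evB (f g : B) : {mpoly K[2]} -> B := mmap constB (at2 f g).

(** The coefficients p and q, the partial derivatives of P at (a, b), do not
    depend on the derivation D. *)
Lemma chain_rule (F : fieldType) (iota : {rmorphism K -> F}) (a b : F) (P : {mpoly K[2]}) :
  exists p q, forall D : F -> F, derivation D -> (forall c, D (iota c) = 0) ->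
    D (mmap iota (at2 a b) P) = p * D a + q * D b.
Proof.
have powE n (c : F) : exists e, forall D, derivation D -> D (c ^+ n) = e * D c.
  case: n => [|n]; last by exists (c ^+ n *+ n.+1) => D dD; rewrite derX // mulrnAl.
  exists 0 => D dD; rewrite mul0r expr0; apply: (addrI (D 1)).
  by rewrite addr0 -{3}[1]mulr1 (derM dD) mulr1 mul1r.
rewrite /mmap; apply: (big_ind (fun z => exists p q, forall D : F -> F, derivation D ->
   (forall c, D (iota c) = 0) -> D z = p * D a + q * D b)).
- by exists 0, 0 => D dD _; rewrite der0 // !mul0r addr0.
- move=> x y [p1 [q1 E1]] [p2 [q2 E2]]; exists (p1 + p2), (q1 + q2) => D dD Dc.
  by rewrite der_add // E1 // E2 //; ring.
move=> m _; rewrite mmap1_at2; have [e1 E1] := powE (m ord0) a; have [e2 E2] := powE (m ord_max) b.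
exists (iota P@_m * b ^+ m ord_max * e1), (iota P@_m * a ^+ m ord0 * e2) => D dD Dc.
rewrite !(derM dD) Dc (E1 D dD) (E2 D dD) mul0r add0r; move: (iota _) (a ^+ _) (b ^+ _) => *; ring.
Qed.

Lemma rmorph_mmap_at2 (R S : comNzRingType) (phi : {rmorphism R -> S}) (f : K -> R) (f' : K -> S)
    (a b : R) (P : {mpoly K[2]}) : (forall c, phi (f c) = f' c) ->
  phi (mmap f (at2 a b) P) = mmap f' (at2 (phi a) (phi b)) P.
Proof. by move=> ff'; apply: rmorph_mmap => // i; have [->|->] := ord2P i. Qed.

Lemma mmap_tofrac (f g : B) (P : {mpoly K[2]}) :
  mmap (@constF K) (at2 f%:F g%:F) P = (evB f g P)%:F.
Proof. by rewrite (rmorph_mmap_at2 (f' := @constF K)). Qed.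

Definition coordinates (f g : B) : Prop :=
  exists P Q, evB f g P = 'X%:P /\ evB f g Q = 'X.

(** By the chain rule J(x, y) = 1 is a multiple of J(f, g). *)
Lemma coordinates_jac f g : coordinates f g -> jac (@Dx K) (@Dy K) f%:F g%:F != 0.
Proof.
case=> P [Q [EP EQ]].
have [p [q E]] := chain_rule (@constF K) f%:F g%:F P.
have [r [s E']] := chain_rule (@constF K) f%:F g%:F Q.
rewrite mmap_tofrac EP in E; rewrite mmap_tofrac EQ in E'.
have Dxx : Dx (K:=K) ('X%:P)%:F = 1.
  rewrite /Dx (fracder_tofrac (@ddx_derivation K)) /ddx map_polyC /= derivX.
  by rewrite !rmorph1.
have Dyx : Dy (K:=K) ('X%:P)%:F = 0.
  by rewrite /Dy (fracder_tofrac (@ddy_derivation K)) /ddy derivC rmorph0.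
have Dxy : Dx (K:=K) ('X)%:F = 0.
  rewrite /Dx (fracder_tofrac (@ddx_derivation K)) /ddx.
  rewrite (_ : map_poly _ _ = 0) ?rmorph0 //; apply/polyP => i.
  by rewrite coef_map coefX coef0; case: (i == 1%N) => /=; rewrite ?derivC // -[1]/(1%:P) derivC.
have Dyy : Dy (K:=K) ('X)%:F = 1.
  by rewrite /Dy (fracder_tofrac (@ddy_derivation K)) /ddy derivX rmorph1.
have e1 := E _ (@Dx_derivation K) (@Dx_const K); have e2 := E _ (@Dy_derivation K) (@Dy_const K).
have e3 := E' _ (@Dx_derivation K) (@Dx_const K); have e4 := E' _ (@Dy_derivation K) (@Dy_const K).
have : Dx ('X%:P)%:F * Dy ('X)%:F - Dy ('X%:P)%:F * Dx ('X)%:F =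
    (p * s - q * r) * jac (@Dx K) (@Dy K) f%:F g%:F.
  rewrite e1 e2 e3 e4 /jac.
  by move: (Dx f%:F) (Dx g%:F) (Dy f%:F) (Dy g%:F) => *; ring.
rewrite Dxx Dyx Dxy Dyy mulr1 mul0r subr0 => E1.
by apply: contra_eq_neq E1 => ->; rewrite mulr0 oner_eq0.
Qed.

Lemma evB_const_supp f g P (c : B) : evB f g P = c -> (forall a, c != constB a) ->
  exists2 m, m \in msupp P & m != 0%MM.
Proof.
move=> E nc; apply: contrapT => no.
have /eqP[] := nc P@_0; rewrite -E /evB.
rewrite [in mmap _ _ _](_ : P = (P@_0)%:MP) ?mmapC //.
apply/mpolyP => m; rewrite mcoeffC; have [->|m0] := eqVneq 0%MM m; rewrite ?eqxx ?mulr1 //.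
rewrite mulr0; apply: memN_msupp_eq0; apply/negP => mP; apply: no; exists m => //.
by rewrite eq_sym.
Qed.

(** [degree_divisibility] for v = - deg_y, with P(f, g) = x: if n = 1 the
    constant residue of f^b / g lets a multiple of f^b cancel the leading term of
    g, and symmetrically if b = 1. *)
Lemma elementary_reduction f g : coordinates f g -> (1 < size f)%N -> (1 < size g)%N ->
  (exists c r, (size (f - constB c * g ^+ r)%R < size f)%N) \/
  (exists c r, (size (g - constB c * f ^+ r)%R < size g)%N).
Proof.
move=> cfg sf sg; have J0 := coordinates_jac cfg.
have f0 : f != 0 by rewrite -size_poly_gt0 ltnW.
have g0 : g != 0 by rewrite -size_poly_gt0 ltnW.
have [F0 G0] : f%:F != 0 /\ g%:F != 0 by rewrite !tofrac_eq0.
pose e := gcdn (size f).-1 (size g).-1.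
have [n nE] : exists n, (size f).-1 = (n * e)%N by apply/dvdnP; exact: dvdn_gcdl.
have [b bE] : exists b, (size g).-1 = (b * e)%N by apply/dvdnP; exact: dvdn_gcdr.
have e0 : (0 < e)%N by rewrite gcdn_gt0; case: (size f) sf => [|[|]].
have n0 : (0 < n)%N by case: n nE sf => //; case: (size f) => [|[|]].
have b0 : (0 < b)%N by case: b bE sg => //; case: (size g) => [|[|]].
have cop : coprime n b.
  by rewrite /coprime -(eqn_pmul2r e0) muln_gcdl -nE -bE mul1n.
have vpoly (h : B) : h != 0 -> negdeg h%:F = - (size h).-1%:Z.
  move=> h0; rewrite -[h%:F]divr1 -(rmorph1 (@tofrac B)) negdeg_quot ?oner_neq0 //.
  by rewrite size_poly1; move: h0; rewrite -size_poly_gt0; move: (size h) => *; lia.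
case: (cfg) => P [_ [EP _]].
have Psupp : exists2 m, m \in msupp P & m != 0%MM.
  apply: (evB_const_supp EP) => a; apply/eqP => /polyC_inj /(congr1 (size \o val)) /=.
  by rewrite size_polyX size_polyC; case: eqP.
have vJ : negdeg (jac (@Dx K) (@Dy K) f%:F g%:F) <= 0.
  move: J0; rewrite /jac /Dx /Dy !(fracder_tofrac (@ddx_derivation K)).
  rewrite !(fracder_tofrac (@ddy_derivation K)) -!rmorphM -rmorphB tofrac_eq0 => J0.
  by rewrite vpoly // oppr_le0.
have vP : mmap (@constF K) (at2 f%:F g%:F) P = 0 \/
     0 <= negdeg (mmap (@constF K) (at2 f%:F g%:F) P).
  right; rewrite mmap_tofrac EP vpoly ?polyC_eq0 ?polyX_eq0 //.
  by rewrite size_polyC polyX_eq0.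
have [nb [c c0 vc]] := degree_divisibility (@Dx_derivation K) (@Dy_derivation K)
  (@Dx_const K) (@Dy_const K) (@negdegM K) (@negdegD K) (@negdeg_constF K) (@negdeg_jac K)
  (@residue_transcendental K) n0 b0 e0 cop (etrans (vpoly f f0) (congr1 (fun k => - k%:Z) nE))
  (etrans (vpoly g g0) (congr1 (fun k => - k%:Z) bE)) F0 G0 J0 vJ Psupp vP.
have small (h k : B) : h != 0 -> k != 0 -> 0 < negdeg (h%:F / k%:F - constF c) ->
    (size (h - constB c * k)%R < size k)%N.
  move=> h0 k0; have [->|d0] := eqVneq (h - constB c * k) 0.
    by rewrite size_poly0 size_poly_gt0.
  have -> : h%:F / k%:F - constF c = (h - constB c * k)%:F / k%:F.
    have kF0 : k%:F != 0 by rewrite tofrac_eq0.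
    by rewrite (rmorphB (@tofrac B)) (rmorphM (@tofrac B)) mulrBl (mulfK kF0).
  by rewrite negdeg_quot // subr_gt0 ltz_nat.
have {}vc : (size (f ^+ b - constB c * g ^+ n)%R < size (g ^+ n)%R)%N.
  by apply: small; rewrite ?expf_neq0 // (rmorphXn (@tofrac B)) (rmorphXn (@tofrac B)).
case: nb => [n1|b1]; [right; exists c^-1, b | left; exists c, n].
- rewrite n1 expr1 in vc; rewrite (_ : _ - _ = - (constB c^-1 * (f ^+ b - constB c * g))).
    by rewrite size_polyN /constB mul_polyC size_scale ?polyC_eq0 ?invr_eq0.
  by rewrite mulrBr mulrA /constB -!polyCM mulVf // mul1r opprB.
- move: vc; rewrite b1 expr1 => /leq_trans; apply.
  have := size_exp g n; move: bE; rewrite b1 mul1n => ->.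
  by move=> /(congr1 succn); rewrite prednK ?size_poly_gt0 ?expf_neq0 // mulnC -nE
    prednK ?size_poly_gt0 // => ->.
Qed.

(** If g depends on x only, then y = U(f) for a polynomial U over K[x], and
    comparing degrees and leading coefficients in y shows that f has degree 1 in
    y with a leading coefficient that is a unit of K[x].  After that x is a
    polynomial in g alone. *)
Lemma coordinates_terminal f g : coordinates f g -> (size g <= 1)%N ->
  exists a b c (q : {poly K}),
    [/\ a != 0, b != 0, g = (a *: 'X + c%:P)%:P & f = constB b * 'X + q%:P].
Proof.
case=> P [Q [EP EQ]] /size1_polyC gE; move: (g`_0) gE => gam gE; rewrite {g}gE in EP EQ *.
have evE R : evB f gam%:P R = (evB 'X gam%:P R) \Po f.
  rewrite /evB (@rmorph_mmap_at2 _ _ (comp_poly f) constB constB); last by move=> c; rewrite /= comp_polyC.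
  by rewrite /= comp_polyX comp_polyC.
rewrite evE in EQ; rewrite evE in EP.
have /eqP := size_comp_poly (evB 'X gam%:P Q) f.
rewrite EQ size_polyX eq_sym muln_eq1 => /andP[/eqP sU /eqP sf].
have {}sf : size f = 2%N by case: (size f) sf => [|[|[|]]].
have {}sU : size (evB 'X gam%:P Q) = 2%N by case: (size _) sU => [|[|[|]]].
have := lead_coef_comp (evB 'X gam%:P Q) (q := f); rewrite sf => /(_ isT).
rewrite EQ lead_coefX sU expr1 => lc1.
have [b b0 fb] : exists2 b, b != 0 & lead_coef f = b%:P.
  have nz : lead_coef (evB 'X gam%:P Q) * lead_coef f != 0 by rewrite -lc1 oner_eq0.
  have /andP[nz1 nz2] : (lead_coef (evB 'X gam%:P Q) != 0) && (lead_coef f != 0).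
    by move: nz; rewrite mulf_eq0 negb_or.
  have /(congr1 (size \o val)) /= := lc1; rewrite size_poly1 size_mul //.
  move: nz1 nz2; rewrite -!size_poly_gt0 => s1 s2 s12.
  have /eqP/size_poly1P[b b0 ->] : size (lead_coef f) = 1%N.
    by move: (size _) (size _) s1 s2 s12 => *; lia.
  by exists b.
have sV : size (evB 'X gam%:P P) = 1%N.
  by rewrite -(size_comp_poly2 _ sf) EP size_polyC polyX_eq0.
have VE : evB 'X gam%:P P = 'X%:P.
  by move: EP; rewrite (size1_polyC (eq_leq sV)) comp_polyC.
have : (mmap (@polyC K) (at2 0 'X) P) \Po gam = 'X.
  rewrite (@rmorph_mmap_at2 _ _ (comp_poly gam) _ (@polyC K)) /=; last by move=> c; rewrite comp_polyC.
  rewrite comp_poly0 comp_polyX; have := congr1 (horner_eval 0) VE.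
  rewrite /evB (@rmorph_mmap_at2 _ _ (horner_eval 0) _ (@polyC K)); last first.
    by move=> c; rewrite /= /horner_eval hornerC.
  by rewrite /= /horner_eval !hornerC hornerX.
move/(congr1 (fun p : {poly K} => (size p).-1)); rewrite size_comp_poly size_polyX => /eqP.
rewrite muln_eq1 => /andP[_ /eqP sg].
have {}sg : size gam = 2%N by case: (size gam) sg => [|[|[|]]].
exists gam`_1, b, gam`_0, f`_0; split=> //.
- have : lead_coef gam != 0 by rewrite lead_coef_eq0 -size_poly_gt0 sg.
  by rewrite lead_coefE sg.
- congr _%:P; apply/polyP => i; rewrite coefD coefZ coefX coefC.
  case: i => [|[|i]] /=; rewrite ?mulr0 ?add0r ?mulr1 ?addr0 //.
  by rewrite nth_default ?sg.
- apply/polyP => i; rewrite coefD /constB coefCM coefX coefC.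
  case: i => [|[|i]] /=; rewrite ?mulr0 ?add0r ?mulr1 ?addr0 //.
    by rewrite -fb lead_coefE sf.
  by rewrite nth_default ?sf.
Qed.

End Reduction.

(** * Composition of polynomial maps *)

Section Composition.
Variables (K : fieldType) (n : nat).
Implicit Types F G H : polymap K n.

Lemma comp_compmap (P : {mpoly K[n]}) F G :
  P \mPo (compmap F G) = (P \mPo F) \mPo G.
Proof.
rewrite [in RHS]/comp_mpoly (@rmorph_mmap _ _ _ _ (comp_mpoly G) _ (@mpolyC n K) _
  (tnth (compmap F G))) // => [c|i]; first exact: comp_mpolyC.
by rewrite tnth_mktuple.
Qed.

Lemma compmapA F G H : compmap F (compmap G H) = compmap (compmap F G) H.
Proof. by apply/eq_from_tnth => i; rewrite !tnth_mktuple comp_compmap. Qed.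

Lemma comp_idmap F : compmap (idpolymap K n) F = F.
Proof.
by apply/eq_from_tnth => i; rewrite !tnth_mktuple comp_mpolyXU -tnth_nth.
Qed.

Lemma compmap_id F : compmap F (idpolymap K n) = F.
Proof. by apply/eq_from_tnth => i; rewrite !tnth_mktuple comp_mpoly_id. Qed.

Lemma GA_id : GA (idpolymap K n).
Proof. by exists (idpolymap K n); rewrite comp_idmap. Qed.

Lemma GA_comp F G : GA F -> GA G -> GA (compmap F G).
Proof.
move=> [F' [FF' F'F]] [G' [GG' G'G]]; exists (compmap G' F'); split.
  by rewrite -compmapA (compmapA G) GG' comp_idmap.
by rewrite -compmapA (compmapA F') F'F comp_idmap.
Qed.

Lemma powmapS F m : powmap F m.+1 = compmap F (powmap F m).
Proof. by []. Qed.

Lemma powmapD F a b : powmap F (a + b) = compmap (powmap F a) (powmap F b).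
Proof.
elim: a => [|a IH]; first by rewrite comp_idmap.
by rewrite addSn !powmapS IH compmapA.
Qed.

Lemma powmapM F a b : powmap F (a * b) = powmap (powmap F a) b.
Proof. by elim: b => [|b IH]; rewrite ?muln0 // mulnS powmapD IH. Qed.

Lemma powmap_id m : powmap (idpolymap K n) m = idpolymap K n.
Proof. by elim: m => // m IH; rewrite powmapS IH comp_idmap. Qed.

Lemma powmap_comp_shift F G m :
  compmap F (powmap (compmap G F) m) = compmap (powmap (compmap F G) m) F.
Proof.
elim: m => [|m IH]; first by rewrite comp_idmap compmap_id.
by rewrite !powmapS -!compmapA IH !compmapA.
Qed.

Lemma powmap_conj F G m : GA F ->
  powmap (compmap F G) m = idpolymap K n -> powmap (compmap G F) m = idpolymap K n.
Proof.
move=> [F' [_ F'F]] E.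
by rewrite -[LHS]comp_idmap -F'F -compmapA powmap_comp_shift E comp_idmap.
Qed.

Definition prodmap (l : seq (polymap K n)) : polymap K n :=
  foldr (@compmap K n) (idpolymap K n) l.

Lemma prodmap_cat l1 l2 : prodmap (l1 ++ l2) = compmap (prodmap l1) (prodmap l2).
Proof. by elim: l1 => [|x l1 IH] /=; rewrite ?comp_idmap // IH compmapA. Qed.

End Composition.

(** * Affine and triangular maps of the plane *)

Section Plane.
Variable K : fieldType.
Local Notation X0 := ('X_ord0 : {mpoly K[2]}).
Local Notation X1 := ('X_ord_max : {mpoly K[2]}).
Local Notation B := {poly {poly K}}.
Implicit Types F G : polymap K 2.

Definition pair_map (a b : {mpoly K[2]}) : polymap K 2 := [tuple a; b].

Lemma polymap2_eq F G : tnth F ord0 = tnth G ord0 -> tnth F ord_max = tnth G ord_max -> F = G.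
Proof.
move=> e0 e1; apply/eq_from_tnth => i.
by have [->|->] := ord2P i.
Qed.

Lemma pair_map0 a b : tnth (pair_map a b) ord0 = a. Proof. by []. Qed.
Lemma pair_map1 a b : tnth (pair_map a b) ord_max = b. Proof. by []. Qed.

Lemma compmap_pair_map a b G : compmap (pair_map a b) G = pair_map (a \mPo G) (b \mPo G).
Proof. by apply: polymap2_eq; rewrite tnth_mktuple. Qed.

Lemma id_pair_map : idpolymap K 2 = pair_map X0 X1.
Proof. by apply: polymap2_eq; rewrite tnth_mktuple. Qed.

Lemma comp_X0 F : X0 \mPo F = tnth F ord0.
Proof. by rewrite comp_mpolyXU -tnth_nth. Qed.

Lemma comp_X1 F : X1 \mPo F = tnth F ord_max.
Proof. by rewrite comp_mpolyXU -tnth_nth. Qed.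

Definition poly_at (x : {mpoly K[2]}) (q : {poly K}) : {mpoly K[2]} := (map_poly (@mpolyC 2 K) q).[x].

Lemma comp_poly_at x q F : poly_at x q \mPo F = poly_at (x \mPo F) q.
Proof.
rewrite /poly_at -(horner_map (comp_mpoly F)) -map_poly_comp; congr _.[_].
by apply: eq_map_poly => c /=; rewrite comp_mpolyC.
Qed.

Lemma poly_at_comp x q r : poly_at x (q \Po r) = poly_at (poly_at x r) q.
Proof. by rewrite /poly_at map_comp_poly horner_comp. Qed.

Lemma poly_at_add x q r : poly_at x (q + r) = poly_at x q + poly_at x r.
Proof. by rewrite /poly_at rmorphD hornerD. Qed.

Lemma poly_at_scale x c q : poly_at x (c *: q) = c *: poly_at x q.
Proof. by rewrite /poly_at map_polyZ hornerZ mul_mpolyC. Qed.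

Lemma poly_at_linear x b c : poly_at x (b *: 'X + c%:P) = b *: x + c%:MP.
Proof. by rewrite poly_at_add poly_at_scale /poly_at map_polyX map_polyC hornerX hornerC. Qed.

Definition tri (a : K) (q : {poly K}) (b c : K) := pair_map (a *: X0 + poly_at X1 q) (b *: X1 + c%:MP).
Definition aff (a b c a' b' c' : K) :=
  pair_map (a *: X0 + b *: X1 + c%:MP) (a' *: X0 + b' *: X1 + c'%:MP).

Definition triangular F := GA F /\ exists a q b c, F = tri a q b c.
Definition affine F := GA F /\ exists a b c a' b' c', F = aff a b c a' b' c'.

Lemma tri_comp a q b c a' q' b' c' :
  compmap (tri a q b c) (tri a' q' b' c') =
  tri (a * a') (a *: q' + (q \Po (b' *: 'X + c'%:P))) (b * b') (b * c' + c).
Proof.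
rewrite compmap_pair_map; congr pair_map; rewrite !comp_mpolyD !comp_mpolyZ ?comp_mpolyC ?comp_X0 ?comp_X1.
  rewrite comp_poly_at comp_X1 pair_map0 pair_map1 poly_at_add poly_at_scale poly_at_comp poly_at_linear.
  by rewrite scalerDr scalerA addrA.
by rewrite pair_map1 scalerDr scalerA -addrA mpolyCD mpolyCM mul_mpolyC.
Qed.

Lemma aff_comp a b c a' b' c' d e f d' e' f' :
  compmap (aff a b c a' b' c') (aff d e f d' e' f') =
  aff (a * d + b * d') (a * e + b * e') (a * f + b * f' + c)
      (a' * d + b' * d') (a' * e + b' * e') (a' * f + b' * f' + c').
Proof.
rewrite compmap_pair_map; congr pair_map; rewrite !comp_mpolyD !comp_mpolyZ ?comp_mpolyC ?comp_X0 ?comp_X1;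
  rewrite pair_map0 pair_map1 -!mul_mpolyC !mpolyCD !mpolyCM; move: X0 X1 => x y; ring.
Qed.

Lemma triangular_comp F G : triangular F -> triangular G -> triangular (compmap F G).
Proof.
move=> [gF [a [q [b [c eF]]]]] [gG [a' [q' [b' [c' eG]]]]]; split; first exact: GA_comp.
by do 4!eexists; rewrite eF eG tri_comp.
Qed.

Lemma affine_comp F G : affine F -> affine G -> affine (compmap F G).
Proof.
move=> [gF [a [b [c [a' [b' [c' eF]]]]]]] [gG [d [e [f [d' [e' [f' eG]]]]]]].
split; first exact: GA_comp.
by do 6!eexists; rewrite eF eG aff_comp.
Qed.

Definition swap := pair_map X1 X0.

Lemma swapK : compmap swap swap = idpolymap K 2.
Proof. by rewrite compmap_pair_map comp_X0 comp_X1 pair_map0 pair_map1 id_pair_map. Qed.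

Lemma affine_swap : affine swap.
Proof.
split; first by exists swap; rewrite swapK.
exists 0, 1, 0, 1, 0, 0; rewrite /swap /aff !scale0r !scale1r !mpolyC0.
by rewrite !addr0 add0r.
Qed.

Lemma tri1_inv q : compmap (tri 1 q 1 0) (tri 1 (- q) 1 0) = idpolymap K 2.
Proof.
rewrite tri_comp !scale1r !mul1r polyC0 !addr0 comp_polyXr addNr id_pair_map.
by rewrite /tri /poly_at rmorph0 horner0 !scale1r mpolyC0 !addr0.
Qed.

Lemma triangular_tri1 q : triangular (tri 1 q 1 0).
Proof.
split; last by exists 1, q, 1, 0.
exists (tri 1 (- q) 1 0); split; first exact: tri1_inv.
by have := tri1_inv (- q); rewrite opprK.
Qed.

End Plane.

(** * The theorem of Jung and van der Kulk *)

Section Tameness.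
Variable K : fieldType.
Local Notation X0 := ('X_ord0 : {mpoly K[2]}).
Local Notation X1 := ('X_ord_max : {mpoly K[2]}).
Local Notation B := {poly {poly K}}.
Implicit Types F G : polymap K 2.

(** Polynomials in two variables as polynomials in y over K[x], for which the
    degree in y is available. *)
Definition toB : {mpoly K[2]} -> B := mmap (@constB K) (at2 'X%:P 'X).
HB.instance Definition _ := GRing.RMorphism.copy toB (mmap (@constB K) (at2 'X%:P 'X)).

Definition fromB : B -> {mpoly K[2]} :=
  horner_eval X1 \o map_poly (horner_eval X0 \o map_poly (@mpolyC 2 K)).
HB.instance Definition _ := GRing.RMorphism.copy fromB
  (horner_eval X1 \o map_poly (horner_eval X0 \o map_poly (@mpolyC 2 K))).

Lemma fromB_polyC q : fromB q%:P = poly_at X0 q.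
Proof. by rewrite /fromB /= map_polyC /= /horner_eval hornerC. Qed.

Lemma fromB_constB c : fromB (constB c) = c%:MP.
Proof. by rewrite /constB fromB_polyC /poly_at map_polyC hornerC. Qed.

Lemma fromB_X : fromB 'X = X1.
Proof. by rewrite /fromB /= map_polyX /horner_eval hornerX. Qed.

Lemma toBK : cancel toB fromB.
Proof.
move=> P; rewrite /toB (@rmorph_mmap _ _ _ _ fromB _ (@mpolyC 2 K) _ (fun i => 'X_i)).
- by rewrite -[RHS]comp_mpoly_id /comp_mpoly; apply: eq_bigr => m _; congr (_ * _);
    apply: eq_bigr => i _; rewrite tnth_mktuple.
- exact: fromB_constB.
move=> i; rewrite /at2; have [->|->] := ord2P i.
  rewrite -[LHS]/(fromB 'X%:P) fromB_polyC.
  by rewrite /poly_at map_polyX hornerX.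
exact: fromB_X.
Qed.

Lemma toB_C c : toB c%:MP = constB c. Proof. exact: mmapC. Qed.
Lemma toB_X0 : toB X0 = 'X%:P. Proof. by rewrite /toB mmapX mmap1U. Qed.
Lemma toB_X1 : toB X1 = 'X. Proof. by rewrite /toB mmapX mmap1U. Qed.

Lemma toB_comp P F : toB (P \mPo F) = evB (toB (tnth F ord0)) (toB (tnth F ord_max)) P.
Proof.
rewrite /comp_mpoly (@rmorph_mmap _ _ _ _ toB _ (@constB K) _
  (at2 (toB (tnth F ord0)) (toB (tnth F ord_max)))) //; first exact: toB_C.
by move=> i; rewrite /at2; have [->|->] := ord2P i.
Qed.

Lemma GA_coordinates F : GA F -> coordinates (toB (tnth F ord0)) (toB (tnth F ord_max)).
Proof.
move=> [G [_ GF]]; exists (tnth G ord0), (tnth G ord_max).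
rewrite -!toB_comp; have := congr1 (fun H : polymap K 2 => tnth H ord0) GF.
have := congr1 (fun H : polymap K 2 => tnth H ord_max) GF.
by rewrite !tnth_mktuple => -> ->; rewrite toB_X0 toB_X1.
Qed.

Definition affine_or_triangular F := affine F \/ triangular F.
Definition tame F := exists2 l, forall x, x \in l -> affine_or_triangular x & F = prodmap l.

Lemma tame_comp x F : affine_or_triangular x -> tame F -> tame (compmap x F).
Proof.
move=> lx [l ll ->]; exists (x :: l) => // y; rewrite inE => /orP[/eqP->//|]; exact: ll.
Qed.

Lemma tame_id : tame (idpolymap K 2).
Proof. by exists [::]. Qed.

Lemma swap_letter : affine_or_triangular (swap K). Proof. by left; exact: affine_swap. Qed.
Lemma letter_tri1 q : affine_or_triangular (tri 1 q 1 0). Proof. by right; exact: triangular_tri1. Qed.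

Lemma tame_swap F : tame (compmap (swap K) F) -> tame F.
Proof.
by move=> /(tame_comp swap_letter); rewrite compmapA swapK comp_idmap.
Qed.

Lemma swap_comp F : compmap (swap K) F = pair_map (tnth F ord_max) (tnth F ord0).
Proof. by rewrite compmap_pair_map comp_X0 comp_X1. Qed.

Lemma swap_compE F : tnth (compmap (swap K) F) ord0 = tnth F ord_max /\
  tnth (compmap (swap K) F) ord_max = tnth F ord0.
Proof. by rewrite swap_comp. Qed.

Lemma tame_terminal F : GA F -> (size (toB (tnth F ord_max)) <= 1)%N -> tame F.
Proof.
move=> gF sF; have [a [c [b [q [a0 c0 e1 e0]]]]] := coordinates_terminal (GA_coordinates gF) sF.
have F1 : tnth F ord_max = a *: X0 + b%:MP by rewrite -[LHS]toBK e1 fromB_polyC poly_at_linear.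
have F0 : tnth F ord0 = c *: X1 + poly_at X0 q.
  by rewrite -[LHS]toBK e0 rmorphD rmorphM /= fromB_constB fromB_X fromB_polyC mul_mpolyC.
have FE : F = compmap (tri c q a b) (swap K).
  rewrite compmap_pair_map !comp_mpolyD !comp_mpolyZ comp_poly_at comp_X0 comp_X1 comp_mpolyC.
  by apply: polymap2_eq; rewrite ?F0 ?F1.
have tE : tri c q a b = compmap F (swap K) by rewrite FE -compmapA swapK compmap_id.
rewrite FE; apply: tame_comp; last first.
  by rewrite -[swap K]compmap_id; apply/(tame_comp swap_letter)/tame_id.
right; split; last by exists c, q, a, b.
by rewrite tE; apply: GA_comp => //; case: (affine_swap K).
Qed.

Lemma tri1_compE q F : compmap (tri 1 q 1 0) F =
  pair_map (tnth F ord0 + poly_at (tnth F ord_max) q) (tnth F ord_max).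
Proof.
rewrite compmap_pair_map !comp_mpolyD !comp_mpolyZ comp_X0 comp_X1 comp_poly_at comp_X1 comp_mpolyC.
by rewrite !scale1r mpolyC0 addr0.
Qed.

Lemma toB_D P Q : toB (P + Q) = toB P + toB Q.
Proof. exact: rmorphD. Qed.

Lemma toB_poly_at q P : toB (poly_at P q) = (map_poly (@constB K) q).[toB P].
Proof.
rewrite /poly_at -horner_map -map_poly_comp; congr _.[_].
by apply: eq_map_poly => c /=; rewrite toB_C.
Qed.

(** Induction on the sum of the degrees in y of the two components: as long as
    both are positive, [elementary_reduction] lowers the sum by composing with an
    elementary map, and [tame_terminal] handles the rest. *)
Theorem jung_van_der_kulk F : GA F -> tame F.
Proof.
have [n le_n] := ubnP (size (toB (tnth F ord0)) + size (toB (tnth F ord_max)))%N.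
elim: n => // n IH in F le_n * => gF.
have [s1|s1] := leqP (size (toB (tnth F ord_max))) 1; first exact: tame_terminal.
have gsF : GA (compmap (swap K) F) by apply: GA_comp => //; case: (affine_swap K).
have [E0 E1] := swap_compE F.
have [s0|s0] := leqP (size (toB (tnth F ord0))) 1.
  by apply/tame_swap/tame_terminal; rewrite ?E1.
have step G c r : GA G -> (size (toB (tnth G ord0) - constB c * toB (tnth G ord_max) ^+ r)%R
    < size (toB (tnth G ord0)))%N ->
    (size (toB (tnth G ord0)) + size (toB (tnth G ord_max)) < n.+1)%N -> tame G.
  move=> gG lt leG; pose q : {poly K} := - c *: 'X^r.
  have [gt _] := triangular_tri1 q.
  have E : tame (compmap (tri 1 q 1 0) G).
    apply: IH; last exact: GA_comp.
    rewrite tri1_compE pair_map0 pair_map1 toB_D toB_poly_at.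
    rewrite /q map_polyZ map_polyXn hornerZ hornerXn rmorphN mulNr.
    by rewrite ltnS in leG; apply: leq_trans leG; rewrite ltn_add2r.
  have := tame_comp (letter_tri1 (- q)) E.
  by rewrite compmapA -{2}[q]opprK tri1_inv comp_idmap.
case: (elementary_reduction (GA_coordinates gF) s0 s1) => [] [c [r lt]].
  exact: step lt le_n.
apply/tame_swap/(step _ c r) => //; first by rewrite E0 E1.
by rewrite E0 E1 addnC.
Qed.

End Tameness.

(** * Elements of finite order *)

Lemma not_path (T : Type) (e : rel T) x p : ~~ path e x p ->
  exists l1 y z l2, x :: p = l1 ++ y :: z :: l2 /\ ~~ e y z.
Proof.
elim: p x => //= y p IH x; rewrite negb_and => /orP[nxy|/IH].
  by exists [::], x, y, p.
by move=> [l1 [u [w [l2 [-> nuw]]]]]; exists (x :: l1), u, w, l2.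
Qed.

Section Words.
Variable K : fieldType.
Local Notation X0 := ('X_ord0 : {mpoly K[2]}).
Local Notation X1 := ('X_ord_max : {mpoly K[2]}).
Local Notation B := {poly {poly K}}.
Local Notation toB := (@toB K).
Local Notation id2 := (idpolymap K 2).
Implicit Types F G S : polymap K 2.

Definition ysize1 F := size (toB (tnth F ord0)).
Definition ysize2 F := size (toB (tnth F ord_max)).

Definition strictT F := triangular F /\ ~ affine F.
Definition strictA F := affine F /\ ~ triangular F.

(** [ready true] describes the maps whose degree in y a triangular, not affine
    map will raise; [ready false] those that an affine, not triangular map turns
    into the former. *)
Definition ready (t : bool) S : Prop :=
  (1 < ysize2 S)%N /\ if t then (ysize1 S <= ysize2 S)%N else (ysize2 S < ysize1 S)%N.

Lemma toB_scale c P : toB (c *: P) = constB c * toB P.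
Proof. by rewrite -mul_mpolyC rmorphM /= toB_C. Qed.

Lemma size_affine_form (f g : B) (a b c : K) : a != 0 -> (1 < size f)%N -> (size g < size f)%N ->
  size (constB a * f + constB b * g + constB c) = size f.
Proof.
move=> a0 sf sg.
have sa : size (constB a * f) = size f by rewrite /constB mul_polyC size_scale ?polyC_eq0.
rewrite -addrA size_polyDl ?sa //; apply: leq_ltn_trans (size_polyD _ _) _.
rewrite gtn_max (leq_ltn_trans (size_polyC_leq1 _) sf) andbT.
by apply: leq_ltn_trans sg; rewrite /constB mul_polyC size_scale_leq.
Qed.

Lemma size_affine_form_leq (f g : B) (a b c : K) s : (0 < s)%N -> (size f <= s)%N ->
  (size g <= s)%N -> (size (constB a * f + constB b * g + constB c)%R <= s)%N.
Proof.
move=> s0 sf sg; apply: leq_trans (size_polyD _ _) _; rewrite geq_max.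
rewrite (leq_trans (size_polyC_leq1 _) s0) andbT.
apply: leq_trans (size_polyD _ _) _; rewrite geq_max /constB !mul_polyC.
by rewrite (leq_trans (size_scale_leq _ _) sf) (leq_trans (size_scale_leq _ _) sg).
Qed.

(** An affine map that is not triangular has a second component involving the
    first variable, so it brings the larger degree to the second place. *)
Lemma ready_strictA F S : strictA F -> ready false S ->
  ready true (compmap F S) /\ (maxn (ysize1 S) (ysize2 S) <= maxn (ysize1 (compmap F S)) (ysize2 (compmap F S)))%N.
Proof.
move=> [[gF [a [b [c [a' [b' [c' FE]]]]]]] nT] [s1 lt].
have a'0 : a' != 0.
  apply/eqP => a'0; apply: nT; split=> //; exists a, (b *: 'X + c%:P), b', c'.
  by rewrite FE /aff /tri a'0 scale0r add0r poly_at_linear addrA.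
have E : compmap F S = pair_map (a *: tnth S ord0 + b *: tnth S ord_max + c%:MP)
    (a' *: tnth S ord0 + b' *: tnth S ord_max + c'%:MP).
  by rewrite FE compmap_pair_map !comp_mpolyD !comp_mpolyZ !comp_mpolyC !comp_X0 !comp_X1.
have e1 : ysize2 (compmap F S) = ysize1 S.
  rewrite /ysize2 E pair_map1 !toB_D !toB_scale toB_C size_affine_form //.
  exact: ltn_trans s1 lt.
have e0 : (ysize1 (compmap F S) <= ysize1 S)%N.
  rewrite {1}/ysize1 E pair_map0 !toB_D !toB_scale toB_C size_affine_form_leq //; last exact: ltnW.
  exact/ltnW/(ltn_trans s1 lt).
split; first by split; rewrite e1 //; apply: ltn_trans s1 lt.
by rewrite e1 (maxn_idPr e0) (maxn_idPl (ltnW lt)).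
Qed.

(** A triangular map that is not affine adds to the first component a polynomial
    of degree at least 2 in the second one, and thereby raises the degree. *)
Lemma ready_strictT F S : strictT F -> ready true S ->
  ready false (compmap F S) /\ (maxn (ysize1 S) (ysize2 S) < maxn (ysize1 (compmap F S)) (ysize2 (compmap F S)))%N.
Proof.
move=> [[gF [a [q [b [c FE]]]]] nA] [s1 le].
have sq : (2 < size q)%N.
  rewrite ltnNge; apply/negP => sq; apply: nA; split=> //.
  have qE : q = q`_1 *: 'X + (q`_0)%:P.
    apply/polyP => i; rewrite coefD coefZ coefX coefC.
    case: i => [|[|i]] /=; rewrite ?mulr0 ?add0r ?mulr1 ?addr0 //.
    by rewrite nth_default // (leq_trans sq).
  exists a, q`_1, q`_0, 0, b, c.
  by rewrite FE /tri {1}qE poly_at_linear /aff scale0r add0r addrA.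
have b0 : b != 0.
  apply/eqP => b0; case: gF => G [/(congr1 (fun H : polymap K 2 => tnth H ord_max)) + _].
  rewrite FE compmap_pair_map pair_map1 b0 scale0r add0r comp_mpolyC id_pair_map pair_map1 => /(congr1 toB).
  rewrite toB_C toB_X1 => /(congr1 (size \o val)) /= sX.
  by have := size_polyC_leq1 (c%:P); rewrite -/(constB c) sX size_polyX.
have E : compmap F S = pair_map (a *: tnth S ord0 + poly_at (tnth S ord_max) q)
    (b *: tnth S ord_max + c%:MP).
  by rewrite FE compmap_pair_map !comp_mpolyD !comp_mpolyZ !comp_mpolyC comp_poly_at !comp_X0 !comp_X1.
have e1 : ysize2 (compmap F S) = ysize2 S.
  rewrite /ysize2 E pair_map1 !toB_D !toB_scale toB_C -[constB b * _]addr0.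
  by rewrite -(mulr0 (constB 0)) size_affine_form // size_poly0 ltnW.
have big : (ysize2 S < size (map_poly (@constB K) q).[toB (tnth S ord_max)])%N.
  have -> : (map_poly (@constB K) q).[toB (tnth S ord_max)] =
      map_poly (@polyC K) q \Po toB (tnth S ord_max).
    by rewrite /comp_poly -map_poly_comp.
  have := size_comp_poly (map_poly (@polyC K) q) (toB (tnth S ord_max)).
  rewrite size_map_polyC -/(ysize2 S); move: (size (_ \Po _)) => u uE.
  have : (2 * (ysize2 S).-1 <= u.-1)%N by rewrite uE leq_mul2r -ltnS prednK ?sq ?orbT // ltnW // ltnW.
  by move: s1; move: (ysize2 S) => s; lia.
have e0 : (ysize2 S < ysize1 (compmap F S))%N.
  rewrite {1}/ysize1 E pair_map0 !toB_D toB_poly_at toB_scale addrC size_polyDl //.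
  apply: leq_ltn_trans big; apply: leq_trans le.
  by rewrite /constB mul_polyC size_scale_leq.
split; first by split; rewrite e1.
by rewrite e1 (maxn_idPr le) (maxn_idPl (ltnW e0)).
Qed.

Definition same_kind F G := (affine F /\ affine G) \/ (triangular F /\ triangular G).
Definition alternating : rel (polymap K 2) := fun F G => ~~ `[<same_kind F G>].

Lemma alternatingP F G : affine_or_triangular F -> affine_or_triangular G -> alternating F G ->
  (strictA F /\ strictT G) \/ (strictT F /\ strictA G).
Proof.
move=> lF lG /asboolP ns; rewrite /same_kind /strictA /strictT /affine_or_triangular in ns lF lG *; tauto.
Qed.

(** For a member of an alternating word this tells its kind, since such a member is
    never both affine and triangular. *)
Definition kindT F := `[<strictT F>].

Lemma kindT_strictA F : strictA F -> kindT F = false.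
Proof. by move=> sF; apply/asboolP; rewrite /strictA /strictT in sF *; tauto. Qed.

Lemma kindT_strictT F : strictT F -> kindT F = true.
Proof. by move=> sF; apply/asboolP. Qed.

Lemma ready_word x p S :
  (forall y, y \in x :: p -> strictA y \/ strictT y) -> path alternating x p ->
  ready (kindT (last x p)) S ->
  ready (~~ kindT x) (compmap (prodmap (x :: p)) S) /\
  (maxn (ysize1 S) (ysize2 S) + count kindT (x :: p) <=
    maxn (ysize1 (compmap (prodmap (x :: p)) S)) (ysize2 (compmap (prodmap (x :: p)) S)))%N.
Proof.
have step y S' : strictA y \/ strictT y -> ready (kindT y) S' ->
    ready (~~ kindT y) (compmap y S') /\
    (maxn (ysize1 S') (ysize2 S') + kindT y <= maxn (ysize1 (compmap y S')) (ysize2 (compmap y S')))%N.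
  case=> [sy|sy].
    by rewrite (kindT_strictA sy) addn0; apply: ready_strictA.
  by rewrite (kindT_strictT sy) addn1; apply: ready_strictT.
elim: p x S => [|y p IH] x S st.
  move=> _ rS; rewrite /= compmap_id addn0; apply: step => //.
  by apply: st; rewrite mem_head.
rewrite [path _ _ _]/= => /andP[xy pp] rS.
have [] := IH y S (fun z zp => st z (mem_behead (s := x :: y :: p) zp)) pp rS.
set S' := compmap _ S => r1 m1.
have tx : kindT x = ~~ kindT y.
  have sx := st x (mem_head _ _); have sy := st y (mem_behead (s := x :: y :: p) (mem_head _ _)).
  have lx : affine_or_triangular x by case: sx => [[h _]|[h _]]; [left|right].
  have ly : affine_or_triangular y by case: sy => [[h _]|[h _]]; [left|right].
  by case: (alternatingP lx ly xy) => [[/kindT_strictA-> /kindT_strictT->]|[/kindT_strictT-> /kindT_strictA->]].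
rewrite -tx in r1.
have [r2 m2] := step x S' (st x (mem_head _ _)) r1.
have E : compmap (prodmap [:: x, y & p]) S = compmap x S' by rewrite -compmapA.
rewrite E; split; first exact: r2.
by rewrite [count _ _]/= addnCA; apply: leq_trans m2; rewrite addnC leq_add2r.
Qed.

Lemma path_strict x p : (forall y, y \in x :: p -> affine_or_triangular y) -> p != [::] ->
  path alternating x p -> forall z, z \in x :: p -> strictA z \/ strictT z.
Proof.
elim: p x => // y p IH x lt _ /= /andP[xy pp] z.
have lp u : u \in y :: p -> affine_or_triangular u by move=> up; apply: lt; rewrite inE up orbT.
have [sx sy] : (strictA x \/ strictT x) /\ (strictA y \/ strictT y).
  by have := alternatingP (lt x (mem_head _ _)) (lp y (mem_head _ _)) xy; tauto.
rewrite inE => /orP[/eqP->//|]; case: p IH pp lp {lt} => [|u p] IH pp lp.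
  by rewrite inE => /eqP->.
exact: IH.
Qed.

(** Apply powers of the word to a map S that is ready for its last letter.  As the
    word alternates cyclically, the result is ready again, and each round raises
    the degree because at least one letter is triangular. *)
Lemma reduced_word_infinite_order x p N :
  (forall y, y \in x :: p -> affine_or_triangular y) -> p != [::] ->
  path alternating x p -> alternating (last x p) x -> (0 < N)%N ->
  powmap (prodmap (x :: p)) N <> id2.
Proof.
move=> lt p0 pp lx N0 wN.
have lastp : last x p \in x :: p by apply: mem_last.
have [y [p' pE]] : exists y p', p = y :: p' by case: p p0 {lt pp lx wN lastp} => // y p' _; exists y, p'.
have st := path_strict lt p0 pp.
have tx : ~~ kindT x = kindT (last x p).
  by case: (alternatingP (lt _ lastp) (lt x (mem_head _ _)) lx) =>
    [[/kindT_strictA-> /kindT_strictT->]|[/kindT_strictT-> /kindT_strictA->]].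
have [S rS] : exists S, ready (kindT (last x p)) S.
  case: (kindT _).
    exists id2; rewrite id_pair_map; split; rewrite /ysize1 /ysize2 pair_map1 toB_X1 size_polyX //.
    by rewrite pair_map0 toB_X0 size_polyC; case: eqP.
  (* The map (y^2, y) is ready for an affine letter; the identity is not. *)
  exists (pair_map (X1 ^+ 2) X1); split; rewrite /ysize1 /ysize2 pair_map1 toB_X1 size_polyX //.
  by rewrite pair_map0 rmorphXn /= toB_X1 size_polyXn.
have grow n : ready (kindT (last x p)) (compmap (powmap (prodmap (x :: p)) n) S) /\
   (maxn (ysize1 S) (ysize2 S) + n <= maxn (ysize1 (compmap (powmap (prodmap (x :: p)) n) S))
      (ysize2 (compmap (powmap (prodmap (x :: p)) n) S)))%N.
  elim: n => [|n [r1 m1]]; first by rewrite addn0 comp_idmap.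
  have [r2 m2] := ready_word st pp r1; rewrite powmapS -compmapA.
  split; first by rewrite -tx; exact: r2.
  apply: leq_trans m2; rewrite addnS -addn1 leq_add // pE /=.
  have ly : affine_or_triangular y by apply: lt; rewrite pE inE mem_head orbT.
  have xy : alternating x y by move: pp; rewrite pE => /andP[].
  by case: (alternatingP (lt x (mem_head _ _)) ly xy) => [[/kindT_strictA-> /kindT_strictT->]|[/kindT_strictT-> _]].
have [_] := grow N; rewrite wN comp_idmap; lia.
Qed.

Lemma prodmap_cons F l : prodmap (F :: l) = compmap F (prodmap l).
Proof. by []. Qed.

Lemma GA_prodmap l : (forall F, F \in l -> GA F) -> GA (prodmap l).
Proof.
elim: l => [|F l IH] gl; first exact: GA_id.
rewrite prodmap_cons; apply: GA_comp; first by apply: gl; rewrite mem_head.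
by apply: IH => G Gl; apply: gl; rewrite inE Gl orbT.
Qed.

Definition conj_letter F := exists U V L,
  [/\ compmap U V = id2, compmap V U = id2, affine_or_triangular L & F = compmap U (compmap L V)].

Lemma letter_GA F : affine_or_triangular F -> GA F.
Proof. by case=> [] []. Qed.

Lemma conj_letter_id F : affine_or_triangular F -> conj_letter F.
Proof. by move=> lF; exists id2, id2, F; split; rewrite ?comp_idmap ?compmap_id. Qed.

Lemma conj_letter_swap F G : GA G -> conj_letter (compmap F G) -> conj_letter (compmap G F).
Proof.
move=> [G' [GG' G'G]] [U [V [L [UV VU lL FG]]]].
exists (compmap G U), (compmap V G'), L; split; last 2 first.
- exact: lL.
- have -> : F = compmap (compmap F G) G' by rewrite -compmapA GG' compmap_id.
  by rewrite FG -!compmapA; reflexivity.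
- by rewrite -compmapA (compmapA U) UV comp_idmap.
- by rewrite -compmapA (compmapA G') G'G comp_idmap.
Qed.

Lemma letter_id : affine_or_triangular id2.
Proof.
left; split; first exact: GA_id.
by exists 1, 0, 0, 0, 1, 0; rewrite id_pair_map /aff !scale0r !scale1r !mpolyC0 !addr0 add0r.
Qed.

Lemma letter_same_kind F G : same_kind F G -> affine_or_triangular (compmap F G).
Proof. by case=> [[aF aG]|[tF tG]]; [left; apply: affine_comp|right; apply: triangular_comp]. Qed.

(** Shorten the word while two cyclically adjacent letters are of the same kind;
    a word that cannot be shortened and has at least two letters would have
    infinite order. *)
Lemma finite_order_word l N : (forall x, x \in l -> affine_or_triangular x) -> (0 < N)%N ->
  powmap (prodmap l) N = id2 -> conj_letter (prodmap l).
Proof.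
move=> + N0; have [n le_n] := ubnP (size l); elim: n => // n IH in l le_n * => lt wN.
case: l le_n lt wN => [|x [|y p]] le_n lt wN.
- exact/conj_letter_id/letter_id.
- by rewrite /= compmap_id; apply/conj_letter_id/lt; rewrite mem_head.
have [pp|npp] := boolP (path alternating x (y :: p)); last first.
  have [l1 [u [w [l2 [lE nuw]]]]] := not_path npp.
  have uw : same_kind u w by move: nuw; rewrite negbK => /asboolP.
  have E : prodmap [:: x, y & p] = prodmap (l1 ++ compmap u w :: l2).
    by rewrite lE !prodmap_cat !prodmap_cons; congr compmap; apply: compmapA.
  rewrite E; apply: IH; last by rewrite -E.
    by move: le_n; rewrite lE !size_cat /= !addnS ltnS.
  move=> z; rewrite mem_cat inE => zl.
  have [->|zuw] := eqVneq z (compmap u w); first exact: letter_same_kind.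
  apply: lt; rewrite lE mem_cat !inE; move: zl; rewrite (negPf zuw) /=.
  by case/orP=> ->; rewrite ?orbT.
have [lx|nlx] := boolP (alternating (last x (y :: p)) x).
  have p0 : y :: p != [::] by [].
  by case: (reduced_word_infinite_order lt p0 pp lx N0 wN).
have sl : same_kind (last y p) x by move: nlx; rewrite negbK => /asboolP.
have lp : affine_or_triangular (last y p) by apply: lt; rewrite inE mem_last orbT.
pose q := belast y p.
have pE : y :: p = rcons q (last y p) by rewrite lastI.
have wE : prodmap [:: x, y & p] = compmap (compmap x (prodmap q)) (last y p).
  by rewrite prodmap_cons pE -cats1 prodmap_cat prodmap_cons compmap_id compmapA.
have gp := letter_GA lp.
have gq : GA (compmap x (prodmap q)).
  have gz z : z \in x :: q -> GA z.
    rewrite inE => /orP[/eqP->|zq]; first by apply/letter_GA/lt; rewrite mem_head.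
    by apply/letter_GA/lt; rewrite inE pE mem_rcons inE zq !orbT.
  by have := GA_prodmap gz.
rewrite wE in wN *; apply: (conj_letter_swap gq).
(* Move the last letter to the front, where it merges with x. *)
have rot : powmap (compmap (last y p) (compmap x (prodmap q))) N = id2.
  exact: powmap_conj wN.
have wE2 : compmap (last y p) (compmap x (prodmap q)) = prodmap (compmap (last y p) x :: q).
  by rewrite prodmap_cons compmapA.
rewrite wE2 in rot *; apply: IH; last exact: rot.
  by move: le_n; rewrite /= /q size_belast.
move=> z; rewrite inE => /orP[/eqP->|zq]; first exact: letter_same_kind.
by apply: lt; rewrite inE pE mem_rcons inE zq !orbT.
Qed.

Theorem finite_order_conj_letter F N : GA F -> (0 < N)%N -> powmap F N = id2 -> conj_letter F.
Proof.
by move=> /jung_van_der_kulk[l lt ->] N0; apply: finite_order_word.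
Qed.

End Words.

(** * Orders in characteristic p *)

Lemma expr_pcharB (R : comNzRingType) p k (x y : R) : p \in [pchar R] ->
  (x - y) ^+ (p ^ k) = x ^+ (p ^ k) - y ^+ (p ^ k).
Proof.
move=> pR; have pk : [pchar R].-nat (p ^ k)%N.
  by rewrite pnatX (pnatE _ (pcharf_prime pR)) pR.
by rewrite exprDn_pchar // exprNn_pchar.
Qed.

Section Orders.
Variables (K : fieldType) (p : nat).
Hypothesis charKp : p \in [pchar K].
Local Notation X0 := ('X_ord0 : {mpoly K[2]}).
Local Notation X1 := ('X_ord_max : {mpoly K[2]}).
Local Notation toB := (@toB K).
Local Notation id2 := (idpolymap K 2).
Implicit Types F G : polymap K 2.

(** The minimal polynomial of M divides (X - 1)^(p^k), so it is (X - 1)^j, and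
    j <= d + 1 by Cayley and Hamilton. *)
Lemma unipotent_order d (M : 'M[K]_d.+1) k s : M ^+ (p ^ k) = 1 -> (d < p ^ s)%N ->
  M ^+ (p ^ s) = 1.
Proof.
have pX : p \in [pchar {poly K}] by rewrite pchar_lalg.
have hX m : horner_mx M (('X - 1%:P) ^+ (p ^ m)) = M ^+ (p ^ m) - 1.
  by rewrite expr_pcharB // rmorphB rmorphXn /= horner_mx_X -rmorphXn expr1n /= rmorph1.
move=> Mk ds; have /mxminpoly_min /dvdp_exp_XsubCP[j _ minE] : horner_mx M (('X - 1%:P) ^+ (p ^ k)) = 0.
  by rewrite hX Mk subrr.
have js : (j <= p ^ s)%N.
  have := dvdp_leq (monic_neq0 (char_poly_monic M)) (mxminpoly_dvd_char M).
  rewrite (eqp_size minE) size_exp_XsubC size_char_poly ltnS => /leq_trans; exact.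
apply/eqP; rewrite -subr_eq0 -hX; apply/eqP/mxminpoly_minP.
by rewrite (eqp_dvdl _ minE) dvdp_exp2l.
Qed.

Lemma affine_form_inj (a b c a' b' c' : K) :
  a *: X0 + b *: X1 + c%:MP = a' *: X0 + b' *: X1 + c'%:MP -> [/\ a = a', b = b' & c = c'].
Proof.
move/(congr1 toB); rewrite !toB_D !toB_scale !toB_C toB_X0 toB_X1 => E.
have coef i j := congr1 (fun P : {poly {poly K}} => P`_i`_j) E.
have := coef 0 1; have := coef 1 0; have := coef 0 0.
rewrite /constB !(coefD, coefCM, coefC, coefX) /=.
by rewrite !(mulr0, mulr1, add0r, addr0) => -> -> ->.
Qed.

Local Notation i0 := (ord0 : 'I_3).
Local Notation i1 := (lift ord0 ord0 : 'I_3).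
Local Notation i2 := (lift ord0 (lift ord0 ord0) : 'I_3).

(** Affine maps in homogeneous coordinates, where composition is the product of
    matrices. *)
Definition aff_of (M : 'M[K]_3) : polymap K 2 :=
  aff (M i0 i0) (M i0 i1) (M i0 i2) (M i1 i0) (M i1 i1) (M i1 i2).
Definition homogeneous_mx (M : 'M[K]_3) := [/\ M i2 i0 = 0, M i2 i1 = 0 & M i2 i2 = 1].

Lemma aff_of_mul (M N : 'M[K]_3) : homogeneous_mx N ->
  aff_of (M * N) = compmap (aff_of M) (aff_of N).
Proof.
case=> N0 N1 N2; rewrite aff_comp /aff_of !mxE !big_ord_recl !big_ord0 N0 N1 N2.
by rewrite !mulr0 !mulr1 !addr0 !addrA.
Qed.

Lemma homogeneous_mul (M N : 'M[K]_3) : homogeneous_mx M -> homogeneous_mx N -> homogeneous_mx (M * N).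
Proof.
move=> [M0 M1 M2] [N0 N1 N2]; rewrite /homogeneous_mx !mxE !big_ord_recl !big_ord0.
by rewrite M0 M1 M2 N0 N1 N2 !mul0r !mulr0 !mul1r !add0r !addr0.
Qed.

Lemma homogeneous1 : homogeneous_mx 1.
Proof. by rewrite /homogeneous_mx !mxE. Qed.

Lemma aff_of1 : aff_of 1 = id2.
Proof.
by rewrite /aff_of /aff !mxE /= !scale0r !scale1r mpolyC0 !addr0 add0r id_pair_map.
Qed.

Lemma powmap_aff_of M m : homogeneous_mx M ->
  powmap (aff_of M) m = aff_of (M ^+ m) /\ homogeneous_mx (M ^+ m).
Proof.
move=> hM; elim: m => [|m [IH hm]]; first by rewrite expr0 aff_of1; split=> //; exact: homogeneous1.
by rewrite exprS powmapS IH aff_of_mul //; split=> //; exact: homogeneous_mul.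
Qed.

Lemma affine_order F k : affine F -> powmap F (p ^ k) = id2 -> powmap F (p ^ 2) = id2.
Proof.
have pr := pcharf_prime charKp.
move=> [_ [a [b [c [a' [b' [c' ->]]]]]]].
pose M : 'M[K]_3 := \matrix_(i, j) nth 0 (nth [::] [:: [:: a; b; c]; [:: a'; b'; c']; [:: 0; 0; 1]] i) j.
have -> : aff a b c a' b' c' = aff_of M by rewrite /aff_of !mxE.
have hM : homogeneous_mx M by rewrite /homogeneous_mx !mxE.
have [-> [h0 h1 h2]] := powmap_aff_of (p ^ k) hM.
have [-> _] := powmap_aff_of (p ^ 2) hM.
rewrite -aff_of1 => E; suff Mk : M ^+ (p ^ k) = 1.
  rewrite (unipotent_order Mk) //; apply: (@leq_trans (2 ^ 2)) => //.
  by rewrite leq_exp2r // prime_gt1.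
have := congr1 (fun G : polymap K 2 => tnth G ord0) E.
have := congr1 (fun G : polymap K 2 => tnth G ord_max) E.
rewrite !pair_map0 !pair_map1 => /affine_form_inj[e10 e11 e12] /affine_form_inj[e00 e01 e02].
apply/matrixP => i j.
have cases (u : 'I_3) : [\/ u = i0, u = i1 | u = i2].
  by case: u => [[|[|[|//]]] lt]; [constructor 1|constructor 2|constructor 3]; apply: val_inj.
have [g0 g1 g2] := homogeneous1.
by case: (cases i) => ->; case: (cases j) => ->; rewrite ?h0 ?h1 ?h2 ?g0 ?g1 ?g2.
Qed.

Lemma tri_id : tri 1 0 1 0 = id2.
Proof. by rewrite id_pair_map /tri /poly_at rmorph0 horner0 !scale1r mpolyC0 !addr0. Qed.

Lemma powmap_tri (a : K) q b c m : exists r d, powmap (tri a q b c) m = tri (a ^+ m) r (b ^+ m) d.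
Proof.
elim: m => [|m [r [d IH]]].
  by exists 0, 0; rewrite !expr0 tri_id.
by rewrite powmapS IH tri_comp -!exprS; do 2!eexists.
Qed.

Lemma powmap_tri1 (q : {poly K}) c m : powmap (tri 1 q 1 c) m =
  tri 1 (\sum_(i < m) (q \Po ('X + (c *+ i)%:P))) 1 (c *+ m).
Proof.
elim: m => [|m IH]; first by rewrite big_ord0 mulr0n tri_id.
by rewrite powmapS IH tri_comp !mul1r !scale1r big_ord_recr mulrSr.
Qed.

Lemma powmap_shear (q : {poly K}) m : powmap (tri 1 q 1 0) m = tri 1 (q *+ m) 1 0.
Proof.
elim: m => [|m IH]; first by rewrite mulr0n tri_id.
by rewrite powmapS IH tri_comp !mul1r !scale1r ?polyC0 !addr0 comp_polyXr mulrSr.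
Qed.

Lemma tri_eq_id (a : K) q b c : tri a q b c = id2 -> [/\ a = 1, q = 0 & b = 1].
Proof.
rewrite id_pair_map => E.
have := congr1 (fun G : polymap K 2 => toB (tnth G ord0)) E.
have := congr1 (fun G : polymap K 2 => toB (tnth G ord_max)) E.
rewrite !pair_map0 !pair_map1 !toB_D !toB_scale toB_C toB_poly_at toB_X0 toB_X1 => E1 E0.
have := congr1 (fun P : {poly {poly K}} => P`_1`_0) E1.
have qX : (map_poly (@constB K) q).['X] = map_poly (@polyC K) q.
  by rewrite -[RHS]comp_polyXr /comp_poly -map_poly_comp.
rewrite {}qX in E0.
have := congr1 (fun P : {poly {poly K}} => P`_0`_1) E0.
rewrite /constB !(coefD, coefCM, coefC, coefX, coef_map) /=.
rewrite !(mulr0, mulr1, add0r, addr0) => a1 ->; split=> //.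
move: E0; rewrite a1 /constB mul1r -[RHS]addr0 => /addrI q0.
by apply/polyP => i; apply: polyC_inj; rewrite -coef_map q0 !coef0.
Qed.

(** The p-th power fixes y since p c = 0; it adds to x a polynomial in y, and
    doing so p times adds p times that polynomial. *)
Lemma powmap_tri1_psquare (q : {poly K}) c : powmap (tri 1 q 1 c) (p ^ 2) = id2.
Proof.
rewrite expnS expn1 powmapM powmap_tri1 mulrn_pchar // powmap_shear.
by rewrite -scaler_nat pcharf0 // scale0r tri_id.
Qed.

(** The p-power order forces the two scalars on the diagonal to be 1, the only
    root of unity of p-power order. *)
Lemma triangular_order F k : triangular F -> powmap F (p ^ k) = id2 -> powmap F (p ^ 2) = id2.
Proof.
move=> [_ [a [q [b [c ->]]]]].
have [r [d ->]] := powmap_tri a q b c (p ^ k); move=> /tri_eq_id[ak _ bk].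
have one (x : K) : x ^+ (p ^ k) = 1 -> x = 1.
  move=> xk; have := expr_pcharB k x 1 charKp; rewrite xk expr1n subrr => /eqP.
  by rewrite expf_eq0 subr_eq0 => /andP[_ /eqP].
by rewrite (one _ ak) (one _ bk) powmap_tri1_psquare.
Qed.

(** Both the hypothesis and the conclusion are invariant under conjugation. *)
Theorem order_dvd_psquare F k : GA F -> powmap F (p ^ k) = id2 -> powmap F (p ^ 2) = id2.
Proof.
move=> gF Fk; have pr := pcharf_prime charKp.
have pk0 : (0 < p ^ k)%N by rewrite expn_gt0 prime_gt0.
have [U [V [L [UV VU lL FE]]]] := finite_order_conj_letter gF pk0 Fk.
have powE m : powmap F m = compmap U (compmap (powmap L m) V).
  elim: m => [|m IH]; first by rewrite comp_idmap UV.
  rewrite [powmap F _]powmapS [powmap L _]powmapS IH FE -!compmapA.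
  congr (compmap _ (compmap _ _)).
  by rewrite compmapA VU comp_idmap.
have Lk : powmap L (p ^ k) = id2.
  have := powE (p ^ k)%N; rewrite Fk => /(congr1 (fun G => compmap V (compmap G U))).
  rewrite comp_idmap VU -!compmapA VU compmap_id compmapA VU comp_idmap => <-.
  by [].
rewrite powE (_ : powmap L _ = id2) ?comp_idmap //.
by case: lL => lL; [apply: affine_order lL Lk|apply: triangular_order lL Lk].
Qed.

End Orders.

(** * Depth and order *)

Lemma least_posP (P : pred nat) m : least_pos P = Some m <->
  [/\ (0 < m)%N, P m & forall k, (0 < k)%N -> P k -> (m <= k)%N].
Proof.
rewrite /least_pos; case: pselect => [exP|noP]; last first.
  by split=> // [[m0 Pm _]]; case: noP; exists m; rewrite m0.
case: ex_minnP => n /andP[n0 Pn] minn; split=> [[<-]|[m0 Pm minm]].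
  by split=> // k k0 Pk; apply: minn; rewrite k0.
by congr Some; apply/eqP; rewrite eqn_leq minn ?m0 // minm.
Qed.

Lemma least_pos_ex (P : pred nat) m : (0 < m)%N -> P m -> exists n, least_pos P = Some n.
Proof.
move=> m0 Pm; rewrite /least_pos; case: pselect => [exP|[]]; first by exists (ex_minn exP).
by exists m; rewrite m0.
Qed.

Section Depth.
Variables (K : fieldType) (n : nat).
Implicit Types (F G : polymap K n) (g : {mpoly K[n]}).

Lemma powmapSr F m : powmap F m.+1 = compmap (powmap F m) F.
Proof. by rewrite -addn1 powmapD [powmap F 1]powmapS compmap_id. Qed.

(** The binomial expansion of (sigma_F - 1)^m, with the coefficients read off from
    the polynomial (X - 1)^m. *)
Lemma iter_Delta F g m : iter m (Delta F) g =
  \sum_(i < m.+1) (('X - 1%:P) ^+ m : {poly K})`_i *: (g \mPo powmap F i).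
Proof.
elim: m => [|m IH].
  by rewrite big_ord_recl big_ord0 expr0 coefC eqxx scale1r addr0 comp_mpoly_id.
rewrite iterS IH /Delta /sigma raddf_sum /=.
have E i : (('X - 1%:P) ^+ m.+1 : {poly K})`_i =
   (if i is j.+1 then (('X - 1%:P) ^+ m)`_j else 0) - (('X - 1%:P) ^+ m)`_i.
  by rewrite exprSr mulrBr mulr1 coefB coefMX; case: i.
under [RHS]eq_bigr do rewrite E scalerBl.
rewrite sumrB; congr (_ - _).
  rewrite [RHS]big_ord_recl scale0r add0r; apply: eq_bigr => i _.
  by rewrite comp_mpolyZ powmapSr comp_compmap.
rewrite [RHS]big_ord_recr /= nth_default ?scale0r ?addr0 //.
by rewrite size_exp_XsubC.
Qed.

Lemma iter_Delta_pchar p k F g : p \in [pchar K] ->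
  iter (p ^ k) (Delta F) g = (g \mPo powmap F (p ^ k)) - g.
Proof.
move=> pK; rewrite iter_Delta expr_pcharB ?pchar_lalg //.
have pk0 : (0 < p ^ k)%N by rewrite expn_gt0 (prime_gt0 (pcharf_prime pK)).
case: (p ^ k)%N pk0 => // m _.
rewrite expr1n big_ord_recl big_ord_recr /= big1 ?add0r => [|i _].
  rewrite !coefB !coefXn !coefC /= eqxx subr0 sub0r scaleN1r scale1r comp_mpoly_id.
  by rewrite addrC.
by rewrite coefB coefXn coefC /= /bump leq0n add1n eqSS (ltn_eqF (ltn_ord i)) subr0 scale0r.
Qed.

Lemma iter_Delta0 F m : iter m (Delta F) 0 = 0.
Proof. by elim: m => // m IH; rewrite iterS IH /Delta /sigma comp_mpoly0 subrr. Qed.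

Lemma iter_Delta_leq F g a b : (a <= b)%N -> iter a (Delta F) g = 0 -> iter b (Delta F) g = 0.
Proof. by move=> le E; rewrite -(subnK le) iterD E iter_Delta0. Qed.

Lemma powmap_idP F m : powmap F m = idpolymap K n <-> forall i, 'X_i \mPo powmap F m = 'X_i.
Proof.
split=> [-> i|E]; first by rewrite comp_mpoly_id.
by apply/eq_from_tnth => i; have := E i; rewrite comp_mpolyXU -tnth_nth tnth_mktuple.
Qed.

Lemma GA_finite_order F N : (0 < N)%N -> powmap F N = idpolymap K n -> GA F.
Proof.
by case: N => // N _ FN; exists (powmap F N); rewrite -powmapS -powmapSr.
Qed.

End Depth.

Section DepthAndOrder.
Variables (K : fieldType) (p : nat).
Hypothesis charKp : p \in [pchar K].
Local Notation id2 := (idpolymap K 2).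
Implicit Types F : polymap K 2.

(** The depth is at most p^k when Delta^(p^k) = sigma^(p^k) - 1 kills both
    variables. *)
Lemma pascal_depth_spec F t : pascal_depth F = Some t ->
  (0 < t)%N /\ forall k, (t <= p ^ k)%N <-> powmap F (p ^ k) = id2.
Proof.
have pk0 k : (0 < p ^ k)%N by rewrite expn_gt0 (prime_gt0 (pcharf_prime charKp)).
rewrite /pascal_depth big_ord_recl big_ord_recl big_ord0.
case e0: (pascal_depth_at F _) => [t0|] //; case e1: (pascal_depth_at F _) => [t1|] //= [<-].
have /least_posP[t0p /eqP D0 m0] := e0; have /least_posP[t1p /eqP D1 m1] := e1.
split; first by rewrite leq_max t0p.
move=> k; rewrite maxn0 geq_max; split=> [/andP[le0 le1]|/powmap_idP E].
  apply/powmap_idP => i; apply/eqP; rewrite -subr_eq0 -iter_Delta_pchar //; apply/eqP.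
  have [->|->] : i = ord0 \/ i = lift ord0 ord0.
    by case: i => [[|[|//]] lt]; [left|right]; apply: val_inj.
    exact: iter_Delta_leq D0.
  exact: iter_Delta_leq D1.
by apply/andP; split; [apply: m0|apply: m1] => //; rewrite iter_Delta_pchar // E subrr.
Qed.

Lemma pascal_finite_of_order F k : powmap F (p ^ k) = id2 -> pascal_finite F.
Proof.
have pk0 : (0 < p ^ k)%N by rewrite expn_gt0 (prime_gt0 (pcharf_prime charKp)).
move=> /powmap_idP E; rewrite /pascal_finite /pascal_depth big_ord_recl big_ord_recl big_ord0.
have ex i : exists m, pascal_depth_at F 'X_i = Some m.
  by apply: (least_pos_ex pk0); rewrite iter_Delta_pchar // E subrr.
by have [m ->] := ex ord0; have [m' ->] := ex (lift ord0 ord0).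
Qed.

(** The order divides p^k as soon as p^k is at least the depth, so it is a power
    p^j; and F^(p^j) = Id makes p^j at least the depth. *)
Lemma GA_order_spec F t : pascal_depth F = Some t ->
  GA_order F = Some (p ^ up_log p t)%N.
Proof.
have pr := pcharf_prime charKp; have p1 := prime_gt1 pr.
move=> /pascal_depth_spec[t0 spec].
have Fk : powmap F (p ^ up_log p t) = id2 by apply/spec/up_logP.
have [m mE] : exists m, GA_order F = Some m.
  by apply: (@least_pos_ex _ (p ^ up_log p t)); rewrite ?Fk // expn_gt0 prime_gt0.
have /least_posP[m0 /eqP Fm minm] := mE; rewrite mE; congr Some.
have mdvd : (m %| p ^ up_log p t)%N.
  have := Fk; rewrite {1}(divn_eq (p ^ up_log p t) m) powmapD mulnC powmapM Fm powmap_id comp_idmap.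
  move=> Fr; rewrite /dvdn -leqn0 leqNgt; apply/negP => r0.
  by have := minm _ r0 (introT eqP Fr); rewrite leqNgt ltn_mod m0.
have /(dvdn_pfactor _ _ pr)[j jle mj] := mdvd.
rewrite mj; congr (_ ^ _)%N; apply/eqP; rewrite eqn_leq jle up_log_min //.
by apply/spec; rewrite -mj.
Qed.

Lemma depth_le_psquare F t : GA F -> pascal_depth F = Some t -> (t <= p ^ 2)%N.
Proof.
move=> gF /pascal_depth_spec[t0 spec]; apply/spec.
by apply: (order_dvd_psquare charKp gF (k := up_log p t)); apply/spec/up_logP/prime_gt1/(pcharf_prime charKp).
Qed.

Lemma shear_order : powmap (tri 1 1%:P 1 0) p = id2 /\
  GA_order (tri 1 1%:P 1 0 : polymap K 2) = Some p.
Proof.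
have pr := pcharf_prime charKp.
have E : powmap (tri 1 1%:P 1 0) p = id2.
  by rewrite powmap_shear mulrn_pchar ?tri_id // pchar_lalg.
split=> //; apply/least_posP; split; rewrite ?prime_gt0 ?E //.
move=> k k0; rewrite powmap_shear => /eqP /tri_eq_id[_ /eqP + _].
rewrite -polyCMn polyC_eq0 -(dvdn_pcharf charKp) => /dvdn_leq -> //.
Qed.

Definition twisted_shear : polymap K 2 := tri 1 'X^(p.-1) 1 1.

(** The p-th power of (x + y^(p-1), y + 1) adds to x the sum of (y + i)^(p-1) over
    i in F_p; at y = 0 this is the sum of i^(p-1), which is p - 1 = -1 by
    Fermat's little theorem. *)
Lemma twisted_shear_order : powmap twisted_shear p <> id2.
Proof.
have pr := pcharf_prime charKp.
rewrite /twisted_shear powmap_tri1 => /tri_eq_id[_ /(congr1 (horner^~ 0)) + _].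
rewrite horner0 horner_sum.
have E (i : 'I_p) : ('X^(p.-1) \Po ('X + (1 *+ i)%:P)).[0] = (i != 0%N :> nat)%:R :> K.
  rewrite comp_Xn_poly !hornerE.
  have [->|i0] := eqVneq (i : nat) 0%N.
    by rewrite mulr0n expr0n; case: p pr => [|[|]].
  have ni : i%:R != 0 :> K.
    rewrite -(dvdn_pcharf charKp); apply/negP => /dvdn_leq.
    by rewrite lt0n i0 leqNgt ltn_ord => /(_ isT).
  apply: (mulfI ni); rewrite -exprS prednK ?prime_gt0 // mulr1.
  exact: (pFrobenius_aut_nat charKp).
under eq_bigr do rewrite E.
case: p pr charKp {E} => // q pr charq; rewrite big_ord_recl add0r.
under eq_bigr do rewrite /=.
rewrite sumr_const card_ord => q0.
have := pcharf0 charq; rewrite -addn1 natrD q0 add0r => /eqP.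
by rewrite oner_eq0.
Qed.

End DepthAndOrder.

(** * The order of a Pascal finite automorphism of the plane *)

Local Open Scope nat_scope.

Theorem theorem1p1 (K : fieldType) (p : nat) (charKp : p \in [pchar K]%R) :
  (forall F : polymap K 2, GA F -> pascal_finite F ->
     exists2 t : nat, pascal_depth F = Some t &
       [/\ GA_order F = Some (p ^ up_log p t),
           GA_order F \in [:: Some 1; Some p; Some (p ^ 2)],
           t <= p ^ 2 &
           [/\ GA_order F = Some 1 <-> t = 1,
               GA_order F = Some p <-> 2 <= t <= p &
               GA_order F = Some (p ^ 2) <-> p + 1 <= t <= p ^ 2]]) /\
  [/\ exists F : polymap K 2, [/\ GA F, pascal_finite F & GA_order F = Some p],
      exists F : polymap K 2,
        [/\ GA F, pascal_finite F & GA_order F = Some (p ^ 2)] &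
      forall F : polymap K 2, GA F -> pascal_finite F ->
        exists2 m : nat, GA_order F = Some m & m <= p ^ 2].
Proof.
have pr := pcharf_prime charKp; have p1 := prime_gt1 pr.
have main (F : polymap K 2) : GA F -> pascal_finite F ->
    exists t k, [/\ pascal_depth F = Some t, GA_order F = Some (p ^ k),
      k = up_log p t & [\/ k = 0 /\ t = 1, k = 1 /\ 2 <= t <= p
                        | k = 2 /\ p + 1 <= t <= p ^ 2]].
  rewrite /pascal_finite; case tE: (pascal_depth F) => [t|] // gF _.
  exists t, (up_log p t); split=> //; first exact: GA_order_spec.
  have [t0 _] := pascal_depth_spec charKp tE.
  have tp2 := depth_le_psquare charKp gF tE.
  have [t1|t1] := leqP t 1.
    have t_1 : t = 1 by lia.
    by constructor 1; rewrite t_1 up_log1.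
  have [tp|tp] := leqP t p.
    constructor 2; split=> //; apply/eqP; rewrite eqn_leq up_log_min ?expn1 //.
    rewrite lt0n; apply/eqP => u0; have := up_logP t p1.
    by rewrite u0 expn0 leqNgt t1.
  constructor 3; rewrite addn1 tp tp2; split=> //; apply/eqP; rewrite eqn_leq up_log_min //=.
  rewrite ltnNge; apply/negP => k1; have := leq_trans (up_logP t p1) (leq_pexp2l (ltnW p1) k1).
  by rewrite expn1 leqNgt tp.
split.
  move=> F gF pF; have [t [k [tE oE kE cases]]] := main F gF pF.
  exists t => //; rewrite oE -kE.
  have p2 : p < p ^ 2 by rewrite -{1}[p]expn1 ltn_exp2l.
  have someE (a b : nat) : Some a = Some b <-> a = b by split=> [[]|->].
  by case: cases => [] [kk tt]; rewrite kk ?expn0 ?expn1; move: p1 p2 tt;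
    move: (p ^ 2) => q p1 p2 tt;
    (split; [by [] | by rewrite !inE eqxx ?orbT | lia | ]);
    rewrite !(propext (someE _ _)); split; lia.
split.
- have [E oE] := shear_order charKp.
  exists (tri 1%R 1%:P%R 1%R 0%R); split=> //.
    by apply: (GA_finite_order (N := p)); rewrite ?prime_gt0.
  by apply: (pascal_finite_of_order charKp (k := 1)); rewrite expn1.
- have E : powmap (twisted_shear K p) (p ^ 2) = idpolymap K 2 by apply: powmap_tri1_psquare.
  have gF : GA (twisted_shear K p).
    by apply: (GA_finite_order (N := p ^ 2)); rewrite ?expn_gt0 ?prime_gt0.
  have pF := pascal_finite_of_order charKp E.
  exists (twisted_shear K p); split=> //.
  have [t [k [tE oE _ cases]]] := main _ gF pF.
  have [_ spec] := pascal_depth_spec charKp tE.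
  have tp : ~~ (t <= p ^ 1).
    by apply/negP => /spec; rewrite expn1; apply: twisted_shear_order.
  rewrite expn1 in tp; rewrite oE; case: cases => [] [kk tt]; rewrite kk //; move: tp tt; lia.
- move=> F gF pF; have [t [k [_ oE _ cases]]] := main F gF pF.
  exists (p ^ k) => //; rewrite leq_pexp2l ?prime_gt0 //.
  by case: cases => [] [-> _].
Qed.
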